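(* Let $k$ be an algebraically closed field of characteristic $11$. There is no superspecial hyperelliptic curve of genus $4$ over $k$.
   Context: A smooth projective irreducible curve $C$ over a field $k$ of characteristic $p>0$ is called superspecial if the ($p$-semilinear) map $F: H^1(C,\mathcal{O}_C)\to H^1(C,\mathcal{O}_C)$ induced by the absolute Frobenius of $C$ is zero. A hyperelliptic curve is a smooth projective irreducible curve admitting a finite separable morphism of degree $2$ to $\mathbb{P}^1_k$. *)

(* Defs.v *)
From HB Require Import structures.
From mathcomp Require Import all_boot all_order all_algebra all_field.
From mathcomp Require Import mpoly.

Set Implicit Arguments.
Unset Strict Implicit.
Unset Printing Implicit Defensive.

Import GRing.Theory.
Local Open Scope ring_scope.

(** Classical varieties over an algebraically closed field [k]: a set of closed
    points with a Zariski topology and a structure sheaf of [k]-valued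
    functions. *)

(** [reg U f] says that [f] restricted to [U] is a section of the structure
    sheaf over the open set [U]; the values of [f] outside [U] are irrelevant.
    No laws are imposed here: varieties are cut out of affine or projective
    space below, where the laws hold. *)
Record fun_space (k : closedFieldType) : Type := Space {
  pt :> Type;
  opn : (pt -> Prop) -> Prop;
  reg : (pt -> Prop) -> (pt -> k) -> Prop
}.

Section Spaces.
Variable k : closedFieldType.
Implicit Types X Y : fun_space k.

Definition nonempty (T : Type) (A : T -> Prop) : Prop := exists x, A x.

Definition closed X (A : X -> Prop) : Prop := opn (fun x => ~ A x).

(** The space on [T] whose basic open sets are the nonvanishing loci of the
    functions [f] with [forms d f], and whose regular functions are locally
    quotients of two such functions with the same [d]. *)
Definition quotient_space (T : Type) (forms : nat -> (T -> k) -> Prop) :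
    fun_space k :=
  let is_open (U : T -> Prop) :=
    exists S : (T -> k) -> Prop,
      (forall f, S f -> exists d, forms d f) /\
      (forall x, U x <-> exists2 f, S f & f x != 0) in
  @Space k T is_open
    (fun U f => forall x, U x ->
       exists (V : T -> Prop) (d : nat) (a b : T -> k),
         [/\ is_open V, V x, forms d a, forms d b &
             forall y, U y -> V y -> b y != 0 /\ f y = a y / b y]).

Definition affine_space (m : nat) : fun_space k :=
  @quotient_space 'rV[k]_m
    (fun _ f => exists F : {mpoly k[m]}, forall x, f x = F.@[fun i => x 0 i]).

(** Points of P^n are the lines of k^(n+1); homogeneous coordinates are those
    of some nonzero vector on the line.  Vanishing of forms and quotients of
    forms of equal degree do not depend on which one. *)
Definition proj_point (n : nat) : Type :=
  {l : {vspace 'rV[k]_n.+1} | \dim l == 1%N}.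

Definition hcoord (n : nat) (x : proj_point n) (i : 'I_n.+1) : k :=
  vpick (val x) 0 i.

Definition proj_space (n : nat) : fun_space k :=
  @quotient_space (proj_point n)
    (fun d f => exists2 F : {mpoly k[n.+1]}, F \is d.-homog &
                forall x, f x = F.@[hcoord x]).

(** Subspace with the induced sheaf: functions that are locally restrictions of
    regular functions.  Used for closed and for open subsets [Z]. *)
Definition sub_space X (Z : X -> Prop) : fun_space k :=
  @Space k {x : X | Z x}
    (fun U => exists2 V : X -> Prop, opn V & forall x, U x <-> V (sval x))
    (fun U f => forall x, U x ->
       exists (V : X -> Prop) (g : X -> k),
         [/\ opn V, V (sval x), reg V g &
             forall y, U y -> V (sval y) -> f y = g (sval y)]).

Definition morphism X Y (phi : X -> Y) : Prop :=
  forall V : Y -> Prop, opn V ->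
    opn (fun x => V (phi x)) /\
    forall g, reg V g -> reg (fun x => V (phi x)) (fun x => g (phi x)).

Definition isomorphic X Y : Prop :=
  exists (phi : X -> Y) (psi : Y -> X),
    [/\ morphism phi, morphism psi, cancel phi psi & cancel psi phi].

Definition affine X : Prop :=
  exists (m : nat) (Z : affine_space m -> Prop),
    closed Z /\ isomorphic X (sub_space Z).

Definition projective X : Prop :=
  exists (n : nat) (Z : proj_space n -> Prop),
    closed Z /\ isomorphic X (sub_space Z).

Definition irreducible X : Prop :=
  (exists x : X, True) /\
  forall A B : X -> Prop, closed A -> closed B ->
    (forall x, A x \/ B x) -> (forall x, A x) \/ (forall x, B x).

(** Strictly increasing chains [Z_0 < ... < Z_d] of irreducible closed
    subsets. *)
Definition has_chain X (d : nat) : Prop :=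
  exists Z : 'I_d.+1 -> X -> Prop,
    (forall i, closed (Z i) /\ irreducible (sub_space (Z i))) /\
    (forall i j : 'I_d.+1, (i < j)%N ->
       (forall x, Z i x -> Z j x) /\ exists2 x, Z j x & ~ Z i x).

Definition krull_dim X (d : nat) : Prop := has_chain X d /\ ~ has_chain X d.+1.

(** Germs at [x] are represented by functions on [X] that are regular on some
    neighbourhood of [x]. *)
Definition near X (x : X) (P : X -> Prop) : Prop :=
  exists U : X -> Prop, [/\ opn U, U x & forall y, U y -> P y].

Definition max_ideal X (x : X) (f : X -> k) : Prop :=
  (exists U : X -> Prop, [/\ opn U, U x & reg U f]) /\ f x = 0.

Definition max_ideal_sq X (x : X) (f : X -> k) : Prop :=
  exists (r : nat) (g h : 'I_r -> X -> k),
    (forall i, max_ideal x (g i) /\ max_ideal x (h i)) /\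
    near x (fun y => f y = \sum_(i < r) g i y * h i y).

(** The cotangent space m_x / m_x^2, which is the fibre at [x] of the sheaf of
    differentials, has dimension [d]. *)
Definition cotangent_dim X (x : X) (d : nat) : Prop :=
  exists t : 'I_d -> X -> k,
    [/\ forall i, max_ideal x (t i),
        forall f, max_ideal x f -> exists c : 'I_d -> k,
          max_ideal_sq x (fun y => f y - \sum_(i < d) c i * t i y) &
        forall c : 'I_d -> k,
          max_ideal_sq x (fun y => \sum_(i < d) c i * t i y) ->
          forall i, c i = 0].

Definition smooth_of_dim X (d : nat) : Prop :=
  krull_dim X d /\ forall x : X, cotangent_dim x d.

Definition smooth_projective_irreducible_curve X : Prop :=
  [/\ projective X, irreducible X & smooth_of_dim X 1].

(** The function field of an irreducible [X]: a field that is the colimit of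
    the rings of regular functions on nonempty open sets, [ev U f] being the
    class of [f] on [U].  It is determined up to unique isomorphism. *)
Record function_field X : Type := FunctionField {
  ff_field :> fieldType;
  ev : (X -> Prop) -> (X -> k) -> ff_field;
  ev1 : forall U, opn U -> nonempty U -> ev U (fun _ => 1) = 1;
  evD : forall U f g, opn U -> nonempty U -> reg U f -> reg U g ->
    ev U (fun x => f x + g x) = ev U f + ev U g;
  evM : forall U f g, opn U -> nonempty U -> reg U f -> reg U g ->
    ev U (fun x => f x * g x) = ev U f * ev U g;
  ev_eq : forall U V f g, opn U -> nonempty U -> reg U f ->
    opn V -> nonempty V -> reg V g ->
    (ev U f = ev V g <->
     exists W, [/\ opn W, nonempty W &
                   forall x, W x -> [/\ U x, V x & f x = g x]]);
  ev_surj : forall z : ff_field, exists U f,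
    [/\ opn U, nonempty U, reg U f & z = ev U f]
}.

(** [phi] is dominant and K(X) / K(Y) is a separable extension of degree [d]. *)
Definition separable_of_degree X Y (phi : X -> Y) (d : nat) : Prop :=
  (forall V, opn V -> nonempty V -> nonempty (fun x => V (phi x))) /\
  exists (KX : function_field X) (KY : function_field Y)
         (iota : {rmorphism KY -> KX}),
    [/\ forall V g, opn V -> nonempty V -> reg V g ->
          iota (ev KY V g) = ev KX (fun x => V (phi x)) (fun x => g (phi x)),
        exists b : 'I_d -> KX, forall z : KX,
          exists! a : {ffun 'I_d -> KY}, z = \sum_(i < d) iota (a i) * b i &
        forall z : KX, exists2 q : {poly KY},
          separable_poly q & root (map_poly iota q) z].

Definition finite_morphism X Y (phi : X -> Y) : Prop :=
  morphism phi /\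
  forall V : Y -> Prop, opn V -> affine (sub_space V) ->
    affine (sub_space (fun x => V (phi x))) /\
    exists (r : nat) (a : 'I_r -> X -> k),
      (forall i, reg (fun x => V (phi x)) (a i)) /\
      forall f, reg (fun x => V (phi x)) f ->
        exists2 b : 'I_r -> Y -> k, forall i, reg V (b i) &
          forall x, V (phi x) -> f x = \sum_(i < r) b i (phi x) * a i x.

Definition hyperelliptic X : Prop :=
  smooth_projective_irreducible_curve X /\
  exists phi : X -> proj_space 1,
    finite_morphism phi /\ separable_of_degree phi 2.

(** H^1(X, O_X) as the colimit of Cech cohomology over all open covers, which
    for H^1 is sheaf cohomology on every space.  A class is represented by a
    1-cocycle on some open cover. *)
Definition open_cover X (I : Type) (U : I -> X -> Prop) : Prop :=
  (forall i, opn (U i)) /\ forall x, exists i, U i x.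

Definition cocycle X (I : Type) (U : I -> X -> Prop) (s : I -> I -> X -> k) :
    Prop :=
  (forall i j, reg (fun x => U i x /\ U j x) (s i j)) /\
  (forall i j l x, U i x -> U j x -> U l x -> s i l x = s i j x + s j l x).

(** Equality of classes in the colimit: on a common refinement [W] the
    difference of the cocycles is a coboundary. *)
Definition cohomologous X (I J : Type)
    (U : I -> X -> Prop) (s : I -> I -> X -> k)
    (V : J -> X -> Prop) (t : J -> J -> X -> k) : Prop :=
  exists (L : Type) (W : L -> X -> Prop) (a : L -> I) (b : L -> J)
         (h : L -> X -> k),
    [/\ open_cover W,
        forall l x, W l x -> U (a l) x /\ V (b l) x,
        forall l, reg (W l) (h l) &
        forall l m x, W l x -> W m x ->
          s (a l) (a m) x - t (b l) (b m) x = h m x - h l x].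

Definition cohomologous0 X (I : Type)
    (U : I -> X -> Prop) (s : I -> I -> X -> k) : Prop :=
  cohomologous U s U (fun _ _ _ => 0).

(** dim_k H^1(X, O_X) = g.  Finitely many classes can always be represented on
    one cover, so the basis [e] is taken on a single [U]. *)
Definition h1_dim X (g : nat) : Prop :=
  exists (I : Type) (U : I -> X -> Prop) (e : 'I_g -> I -> I -> X -> k),
    let comb (c : 'I_g -> k) i j x := \sum_(n < g) c n * e n i j x in
    [/\ open_cover U,
        forall n, cocycle U (e n),
        forall (J : Type) (V : J -> X -> Prop) (s : J -> J -> X -> k),
          open_cover V -> cocycle V s ->
          exists c : 'I_g -> k, cohomologous V s U (comb c) &
        forall c : 'I_g -> k, cohomologous0 U (comb c) -> forall n, c n = 0].

Definition genus X (g : nat) : Prop := h1_dim X g.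

(** The absolute Frobenius is the identity on points and the [p]-th power map
    on the structure sheaf. *)
Definition frobenius X (p : nat) (I : Type) (s : I -> I -> X -> k) :
    I -> I -> X -> k :=
  fun i j x => s i j x ^+ p.

Definition superspecial (p : nat) X : Prop :=
  smooth_projective_irreducible_curve X /\
  forall (I : Type) (U : I -> X -> Prop) (s : I -> I -> X -> k),
    open_cover U -> cocycle U s -> cohomologous0 U (frobenius p s).

End Spaces.

(* Main.v *)
From HB Require Import structures.
From mathcomp Require Import all_boot all_order all_algebra.
From mathcomp Require Import mpoly.
From mathcomp Require Import ring zify.
From Stdlib Require Import Classical ClassicalEpsilon FunctionalExtensionality PropExtensionality.
Require Import Defs.

(** In characteristic different from 2 a hyperelliptic curve of genus g is
    y^2 = f(x) with f a squarefree binary form of degree 2g+2, and the classes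
    of y/x, ..., y/x^g form a basis of H^1.  Frobenius raises y/x^i to
    y^11/x^(11i) = f^5 y/x^(11i), so a superspecial curve of genus 4 in
    characteristic 11 forces the coefficients of f^5 at the exponents 11i-j,
    1 <= i, j <= 4, to vanish.  No squarefree f of degree 9 or 10 has this
    property ([genus4_absurd]).

    The algebra.  The condition says that f^5 is a sum of R_i X^(11i) with
    deg R_i <= 6, which is stable under translation, and it is symmetric under
    f -> X^10 f(1/X).  Hence two of the simple roots of f may be moved to 0 and
    infinity, so that f = X g with deg g = 8 and g(0) != 0.  The vanishing
    coefficients of g^5 next to its two ends determine four coefficients of g
    each, through g (g^5)' = 5 g' g^5; these two sets overlap, and what
    is left up to scaling is X^8 + 1 and one more polynomial, both excluded by a
    coefficient in the middle of g^5 ([octic_fifth_power_absurd]).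

    The geometry.  A rational function is represented by any function that
    agrees with it on a nonempty open set, and [ext P r] says that it is regular
    at P.  Over each standard chart of the projective line with coordinate x, the
    ring of regular functions is a finite torsion-free k[x]-module of rank 2;
    completing the square gives an y with y^2 in k[x], and one of minimal degree
    generates the ring, because norms bound denominators; smoothness makes
    y^2 = f(x) squarefree ([chart_dcover]).  Every point of such a chart carries
    functions with an arbitrary principal part there and no other pole, so the
    chart is acyclic ([chart_acyclic]), and H^1 is computed by the two charts:
    comparing the square roots y and y' of the two charts gives
    y' = c y / x^m up to clearing denominators ([odd_coordinates_proportional]),
    and a function on the overlap is a difference of functions on the charts
    exactly when its coefficients at y/x^j, 0 < j < m, vanish
    ([splits_laurent], [laurent_of_splits]).  Thus genus 4 means m = 5
    ([h1_dim_lower], [h1_dim_upper]), and superspeciality becomes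
    the condition on f^5 ([superspecial_cartier]). *)

Set Implicit Arguments.
Unset Strict Implicit.
Unset Printing Implicit Defensive.

Import GRing.Theory.
Local Open Scope ring_scope.

(** * Fifth powers of polynomials in characteristic 11 *)

(** Deduces one equation from another by an identity that [ring] can check. *)
Lemma subr_congr (V : zmodType) (a b x y : V) : a = b -> x - y = a - b -> x = y.
Proof. by move=> -> /eqP; rewrite subrr subr_eq0 => /eqP. Qed.

Section Algebra.
Variable k : closedFieldType.
Hypothesis e11 : 11%:R = 0 :> k.

Lemma natr_mod11 n : (n %% 11)%:R = n%:R :> k.
Proof. by rewrite {2}(divn_eq n 11) natrD natrM e11 mulr0 add0r. Qed.

Lemma natr_eq0_11 n : (n%:R == 0 :> k) = (11 %| n)%N.
Proof.
have ch : 11%N \in [pchar k] by rewrite inE /= e11 eqxx.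
by rewrite (dvdn_pcharf ch).
Qed.

Lemma modular_eq (a b : nat) (s : k) : a = b %[mod 11] -> a%:R * s = b%:R * s.
Proof. by move=> h; rewrite -(natr_mod11 a) h natr_mod11. Qed.

(** Coefficients of a product as residues modulo 11 in nat, so that one coefficient
    of a fifth power can be found by evaluation. *)
Definition conv11 (P Q : nat -> nat) (n : nat) : nat :=
  (foldr addn 0 [seq P i * Q (n - i)%N | i <- iota 0 n.+1] %% 11)%N.

(** The factor [b ^+ i] carries along the scaling X -> b X of the variable. *)
Lemma coef_conv11 (p q : {poly k}) (P Q : nat -> nat) b :
  (forall i, p`_i = (P i)%:R * b ^+ i) -> (forall i, q`_i = (Q i)%:R * b ^+ i) ->
  forall n, (p * q)`_n = (conv11 P Q n)%:R * b ^+ n.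
Proof.
move=> hp hq n; rewrite coefM natr_mod11.
rewrite foldrE big_map natr_sum mulr_suml.
rewrite -(big_mkord xpredT (fun i => p`_i * q`_(n - i))) /index_iota subn0.
rewrite !big_seq; apply: eq_bigr => i; rewrite mem_iota add0n ltnS => /andP[_ le_in].
have -> : b ^+ n = b ^+ i * b ^+ (n - i) by rewrite -exprD subnKC.
by rewrite hp hq natrM; ring.
Qed.

(** With G = g^5 one has g G' = 5 g' G.  When G has no term in X^2, ..., X^5, the
    coefficient of X^n on the left is g_n G_1, and only two terms are left on the
    right. *)
Lemma fifth_power_start (g : {poly k}) : g`_0 != 0 ->
    (forall n, (n < 4)%N -> (g ^+ 5)`_n.+2 = 0) ->
  forall n, (0 < n < 5)%N ->
    n.+1%:R * g`_0 * g`_n.+1 = (1 - 5%:R * n%:R) * g`_1 * g`_n.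
Proof.
move=> g0 hG n /andP[n0 n5]; set G := g ^+ 5 in hG.
have eqG : g * G^`() = 5%:R * (g^`() * G).
  rewrite /G deriv_exp /= -mulr_natl; ring.
have G0 : G`_0 = g`_0 ^+ 5.
  by rewrite -!horner_coef0 /G horner_exp.
have G1 : G`_1 = 5%:R * g`_0 ^+ 4 * g`_1.
  have := coef_deriv G 0; rewrite mulr1n => <-.
  have := coef_deriv g 0; rewrite mulr1n => <-.
  rewrite /G deriv_exp -!horner_coef0 /= hornerMn hornerM horner_exp.
  rewrite -mulr_natl; ring.
have e1 : (g * G^`())`_n = g`_n * G`_1.
  rewrite coefMr big_ord_recl /= subn0 coef_deriv mulr1n big1 ?addr0 // => i _.
  rewrite coef_deriv hG ?mul0rn ?mulr0 //.
  by have := ltn_ord i; lia.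
have e2 : (g^`() * G)`_n = g`_n.+1 *+ n.+1 * G`_0 + g`_n *+ n * G`_1.
  rewrite coefMr big_ord_recl /= subn0 coef_deriv.
  case: n n0 n5 {e1} => // n _ n5.
  rewrite big_ord_recl /= /bump /= coef_deriv.
  rewrite big1 ?addr0; first by rewrite subn1.
  move=> i _; rewrite /bump /= -[(1 + (1 + i))%N]/(i.+2) hG ?mulr0 //.
  have := ltn_ord i; lia.
have e5 : 5%:R != 0 :> k by rewrite natr_eq0_11.
have/(congr1 (fun p : {poly k} => p`_n)) := eqG.
rewrite mulr_natl coefMn e1 e2 G0 G1 -mulr_natl => h.
apply: (mulfI (mulf_neq0 e5 (expf_neq0 4 g0))).
by apply: (subr_congr (esym h)); ring.
Qed.

(** Up to X^5, g is the fifth root of g_0^5 (1 + 5 u X), and 1/5 = 9 modulo 11: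
    the constants are the residues of the coefficients of (1 + 5 X)^9. *)
Lemma fifth_power_coefs (g : {poly k}) : g`_0 != 0 ->
    (forall n, (n < 4)%N -> (g ^+ 5)`_n.+2 = 0) ->
  let u := g`_1 / g`_0 in
  [/\ g`_2 = 9%:R * g`_0 * u ^+ 2, g`_3 = 6%:R * g`_0 * u ^+ 3,
      g`_4 = g`_0 * u ^+ 4 & g`_5 = 5%:R * g`_0 * u ^+ 5].
Proof.
move=> g0 /(fifth_power_start g0) h u.
have gu : g`_1 = g`_0 * u by rewrite /u mulrCA divff // mulr1.
have [h1 h2 h3 h4] := And4 (h 1 isT) (h 2 isT) (h 3 isT) (h 4 isT).
have nz n : ~~ (11 %| n)%N -> n%:R != 0 :> k by rewrite natr_eq0_11.
have key (n a b : nat) (x y z : k) : ~~ (11 %| n)%N -> 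
   (n * a = b %[mod 11])%N -> n%:R * g`_0 * x = b%:R * (g`_0 * y) ->  x = a%:R * y.
  move=> nn nab e; apply: (mulfI (mulf_neq0 (nz _ nn) g0)).
  rewrite e -(modular_eq _ nab) natrM; ring.
have E2 : g`_2 = 9%:R * (g`_0 * u ^+ 2).
  apply: (@key 2 9 7) => //.
  rewrite h1 gu; transitivity (7%:R * (g`_0 * (g`_0 * u ^+ 2)) - 11%:R * (g`_0 * (g`_0 * u ^+ 2))).
     ring. 
  by rewrite e11 mul0r subr0.
have E3 : g`_3 = 6%:R * (g`_0 * u ^+ 3).
  apply: (@key 3 6 7) => //.
  rewrite h2 E2 gu; transitivity (7%:R * (g`_0 * (g`_0 * u ^+ 3)) - 11%:R * (8%:R * g`_0 * (g`_0 * u ^+ 3))).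
     ring. 
  by rewrite e11 mul0r subr0.
have E4 : g`_4 = 1%:R * (g`_0 * u ^+ 4).
  apply: (@key 4 1 4) => //.
  rewrite h3 E3 gu; transitivity (4%:R * (g`_0 * (g`_0 * u ^+ 4)) - 11%:R * (8%:R * g`_0 * (g`_0 * u ^+ 4))).
     ring. 
  by rewrite e11 mul0r subr0.
have E5 : g`_5 = 5%:R * (g`_0 * u ^+ 5).
  apply: (@key 5 5 3) => //.
  rewrite h4 E4 gu; transitivity (3%:R * (g`_0 * (g`_0 * u ^+ 5)) - 11%:R * (2%:R * g`_0 * (g`_0 * u ^+ 5))).
     ring. 
  by rewrite e11 mul0r subr0.
by rewrite E2 E3 E4 E5 mul1r !mulrA.
Qed.


Lemma poly_eq_nonzero (p q : {poly k}) :
  (forall z, z != 0 -> p.[z] = q.[z]) -> p = q.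
Proof.
move=> h; apply/eqP; rewrite -subr_eq0; apply: contraT => nz.
have : 'X * (p - q) != 0 by rewrite mulf_neq0 ?polyX_eq0.
case/closed_nonrootP=> z /negP[]; rewrite rootE !hornerE.
by case: (eqVneq z 0) => [->|/h ->]; rewrite ?mul0r // subrr mulr0.
Qed.

(** The reversed polynomial X^d p(1/X), for p of degree at most d. *)
Definition recip d (p : {poly k}) : {poly k} := \poly_(i < d.+1) p`_(d - i).

Lemma coef_recip d p i : (recip d p)`_i = if (i <= d)%N then p`_(d - i) else 0.
Proof. by rewrite coef_poly ltnS. Qed.

Lemma horner_recip d (p : {poly k}) z : (size p <= d.+1)%N -> z != 0 ->
  (recip d p).[z] = z ^+ d * p.[z^-1].
Proof.
move=> sp nz; rewrite horner_poly (horner_coef_wide _ sp) mulr_sumr.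
rewrite (reindex_inj rev_ord_inj) /=; apply: eq_bigr => i _.
rewrite !subSS subKn; last by rewrite -ltnS.
have -> : z ^+ d = z ^+ (d - i) * z ^+ i by rewrite -exprD subnK // -ltnS.
by rewrite exprVn mulrCA -!mulrA divff ?expf_neq0 // mulr1.
Qed.

Lemma recipM m n (p q : {poly k}) : (size p <= m.+1)%N -> (size q <= n.+1)%N ->
  recip (m + n) (p * q) = recip m p * recip n q.
Proof.
move=> sp sq; apply: poly_eq_nonzero => z nz.
rewrite hornerM !horner_recip //.
  by rewrite exprD hornerM; ring.
apply: leq_trans (size_polyMleq _ _) _; lia.
Qed.

Lemma size_expn_leq d (p : {poly k}) n :
  (size p <= d.+1)%N -> (size (p ^+ n) <= (d * n).+1)%N.
Proof.
move=> sp; apply: leq_trans (size_poly_exp_leq _ _) _.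
by rewrite ltnS leq_mul2r; apply/orP; right; lia.
Qed.

Lemma recipX d (p : {poly k}) n : (size p <= d.+1)%N -> recip (d * n) (p ^+ n) = recip d p ^+ n.
Proof.
move=> sp; elim: n => [|n IH].
  apply/polyP=> i; rewrite muln0 coef_recip !expr0 coef1.
  by case: i => [|i]; rewrite ?coef1.
rewrite mulnS [p ^+ _]exprS exprS recipM ?IH //.
exact: size_expn_leq.
Qed.

(** [fifth_power_coefs] for g and for its reversal gives the coefficients of
    g from u = g_1/g_0 and from w = g_7/g_8.  The coefficients of X^3, X^4 and X^5
    are found twice; if u = 0 this leaves g = a + c X^8, and otherwise u w = -1 and
    g(X) = g_0 h(u X) for a single polynomial h. *)
Lemma octic_fifth_power_absurd (g : {poly k}) : (size g <= 9)%N -> g`_0 != 0 -> g`_8 != 0 ->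
  (forall n, (n < 4)%N -> (g ^+ 5)`_n.+2 = 0) ->
  (forall n, (n < 4)%N -> (g ^+ 5)`_(38 - n) = 0) ->
  (g ^+ 5)`_13 = 0 -> (g ^+ 5)`_16 = 0 -> False.
Proof.
move=> sg g0 g8 hlo hhi h13 h16.
have [E2 E3 E4 E5] := fifth_power_coefs g0 hlo.
pose r := recip 8 g.
have r0 : r`_0 != 0 by rewrite coef_recip.
have hr n : (n < 4)%N -> (r ^+ 5)`_n.+2 = 0.
  move=> n4; rewrite -recipX // coef_recip ifT; last by lia.
  have -> : (8 * 5 - n.+2 = 38 - n)%N by lia.
  exact: hhi.
have := fifth_power_coefs r0 hr; rewrite !coef_recip /=.
rewrite !subSS !subn0.
move: E2 E3 E4 E5; set a := g`_0 in g0 *; set c := g`_8 in g8 *.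
set u := _ / a; set w := _ / c => E2 E3 E4 E5 [E6 E5' E4' E3'].
have [u0|nu] := eqVneq u 0.
  have w0 : w = 0.
    apply/eqP; move: E4'; rewrite E4 u0 expr0n mulr0 => /esym/eqP.
    by rewrite mulf_eq0 (negPf g8) /= expf_eq0.
  have g1 : g`_1 = 0 by apply/eqP; move/eqP: u0; rewrite mulf_eq0 invr_eq0 (negPf g0) orbF.
  have g7 : g`_7 = 0 by apply/eqP; move/eqP: w0; rewrite mulf_eq0 invr_eq0 (negPf g8) orbF.
  have gE : g = a%:P + c *: 'X^8.
    apply/polyP=> i; rewrite coefD coefC coefZ coefXn.
    do 9?[case: i => [|i] /=; first by
       rewrite ?mulr0 ?mulr1 ?addr0 ?add0r ?E2 ?E3 ?E4 ?E5 ?E6 ?u0 ?w0 ?expr0n ?mulr0].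
    by rewrite mulr0 addr0 nth_default // (leq_trans sg).
  have : g ^+ 5 = (a ^+ 5)%:P + (5%:R * a ^+ 4 * c) *: 'X^8 + (10%:R * a ^+ 3 * c ^+ 2) *: 'X^16
      + (10%:R * a ^+ 2 * c ^+ 3) *: 'X^24 + (5%:R * a * c ^+ 4) *: 'X^32 + c ^+ 5 *: 'X^40.
    rewrite gE -!mul_polyC !(polyCM, polyC_exp, polyC_natr).
    by rewrite (exprM 'X 8 2) (exprM 'X 8 3) (exprM 'X 8 4) (exprM 'X 8 5); ring.
  move/(congr1 (fun p : {poly k} => p`_16)); rewrite h16 !coefD !coefZ !coefXn coefC /=.
  rewrite !mulr0 mulr1 !addr0 add0r => /esym/eqP.
  apply/negP; rewrite !mulf_neq0 ?expf_neq0 //.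
  by rewrite natr_eq0_11.
have aw : a * u ^+ 3 = - (c * w ^+ 5).
  apply: (mulfI (_ : 6%:R != 0)); first by rewrite natr_eq0_11.
  transitivity (5%:R * c * w ^+ 5); first by rewrite -E3' E3; ring.
  by apply: (subr_congr (congr1 (fun z => z * (c * w ^+ 5)) e11)); ring.
have E4c : a * u ^+ 4 = c * w ^+ 4 by rewrite -E4' E4.
(* from a u^3 = - c w^5 and a u^4 = c w^4 *)
have uw : u * w = -1.
  have nw : w != 0.
    apply: contraNneq nu => w0; move/eqP: E4c; rewrite w0 expr0n mulr0 mulf_eq0 (negPf g0) /=.
    by rewrite expf_eq0.
  apply: (mulfI (mulf_neq0 g8 (expf_neq0 4 nw))).
  transitivity (u * (c * w ^+ 5)); first ring.
  have -> : c * w ^+ 5 = - (a * u ^+ 3) by rewrite aw opprK.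
  by rewrite -E4c; ring.
have wE : w = - u^-1 by apply: (mulfI nu); rewrite uw mulrN divff.
have cE : c = a * u ^+ 8.
  apply: (mulIf (_ : w ^+ 4 != 0)); first by rewrite wE expf_neq0 // oppr_eq0 invr_eq0.
  by rewrite -E4c wE; field.
(* the coefficients of h modulo 11; that of X^13 in h^5 is 4 *)
pose K := nth 0%N [:: 1; 1; 9; 6; 1; 5; 9; 10; 1]%N.
pose q := a^-1 *: g.
have qE i : q`_i = (K i)%:R * u ^+ i.
  rewrite coefZ.
  case: (ltnP i 9) => [|i9]; last first.
    by rewrite /K !nth_default ?mulr0 ?mul0r // (leq_trans sg i9).
  have e10 : 10%:R = -1 :> k by apply: (subr_congr e11); ring.
  have g1 : g`_1 = a * u by rewrite mulrC divfK.
  have g7 : g`_7 = c * w by rewrite mulrC divfK.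
  case: i => [|[|[|[|[|[|[|[|[|]]]]]]]]] //= _; rewrite -?/a -?/c ?E2 ?E3 ?E4 ?E5 ?E6 ?g1 ?g7 ?cE ?wE ?e10; rewrite /K /= ?e10; by field; rewrite ?g0 ?nu.
have gE : g = a *: q by rewrite scalerA divff // scale1r.
have q2 := coef_conv11 qE qE; have q4 := coef_conv11 q2 q2; have := coef_conv11 q4 qE 13.
have -> : q * q * (q * q) * q = q ^+ 5 by ring.
move: h13; rewrite gE exprZn coefZ => /eqP; rewrite mulf_eq0 expf_eq0 (negPf g0) /=.
move=> /eqP -> /esym/eqP; rewrite mulf_eq0 expf_eq0 (negPf nu) /= orbF.
by rewrite natr_eq0_11; vm_compute.
Qed.
End Algebra.

Section Reduction.
Variable k : closedFieldType.
Hypothesis e11 : 11%:R = 0 :> k.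

(** The exponents below 51 that are not of the form 11 i - j with i and j between 1
    and 4. *)
Definition exponent_allowed n := (n < 51)%N && (n %% 11 < 7)%N.
Definition cartier_null (F : {poly k}) := forall n, ~~ exponent_allowed n -> F`_n = 0.

Lemma cartier_null_sum (I : Type) (r : seq I) (P : pred I) (F : I -> {poly k}) :
  (forall i, P i -> cartier_null (F i)) -> cartier_null (\sum_(i <- r | P i) F i).
Proof. by move=> h n hn; rewrite coef_sum big1 // => i Pi; apply: h. Qed.

Lemma cartier_nullMXn (T : {poly k}) j : (size T <= 7)%N -> (j < 5)%N ->
  cartier_null (T * 'X^11 ^+ j).
Proof.
move=> sT j5 n; rewrite -exprM coefMXn; case: ltnP => // le_n nok.
rewrite nth_default // (leq_trans sT) // leqNgt; apply: contra nok => lt7.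
rewrite /exponent_allowed -(subnKC le_n) mulnC modnMDl modn_small; lia.
Qed.

(** Writing the exponents as 11 i + s, the allowed ones have i < 5 and s < 7. *)
Lemma cartier_null_decomp F : cartier_null F ->
  exists2 T : nat -> {poly k}, forall i, (size (T i) <= 7)%N &
    F = \sum_(i < 5) T i * 'X^11 ^+ i.
Proof.
move=> hF; exists (fun i => \poly_(s < 7) F`_(11 * i + s)%N).
  by move=> i; apply: size_poly.
apply/polyP=> n; rewrite coef_sum.
under eq_bigr do rewrite -exprM coefMXn coef_poly.
have [nok|nnok] := boolP (exponent_allowed n).
  have n5 : (n %/ 11 < 5)%N by move: nok; rewrite /exponent_allowed; lia.
  rewrite (bigD1 (Ordinal n5)) //= big1 ?addr0.
    case: ltnP => [|_]; first by have := divn_eq n 11; lia.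
    rewrite ifT; last by move: nok; rewrite /exponent_allowed; lia.
    by congr nth; lia.
  move=> i ni; case: ltnP => // le_n; case: ltnP => // lt7.
  case/eqP: ni; apply: val_inj => /=; lia.
rewrite hF // big1 // => i _; case: ltnP => // le_n; case: ltnP => // lt7.
case/negP: nnok; rewrite /exponent_allowed; have := ltn_ord i; lia.
Qed.

(** (X + c)^11 = X^11 + c^11, and the degrees of the T_i do not change. *)
Lemma cartier_null_translate F c : cartier_null F -> cartier_null (F \Po ('X + c%:P)).
Proof.
case/cartier_null_decomp => T sT ->; rewrite rmorph_sum /=.
apply: cartier_null_sum => i _.
rewrite rmorphM /= !rmorphXn /= comp_polyX.
have -> : ('X + c%:P) ^+ 11 = 'X^11 + (c ^+ 11)%:P :> {poly k}.
  have ch : 11%N \in [pchar {poly k}] by rewrite inE /= -polyC_natr e11 polyC0 eqxx.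
  by have := pFrobenius_autD_comm ch (mulrC 'X c%:P); rewrite !pFrobenius_autE polyC_exp.
rewrite [_ + (c ^+ 11)%:P]addrC exprDn mulr_sumr; apply: cartier_null_sum => j _.
have -> : (T i \Po ('X + c%:P)) * ((c ^+ 11)%:P ^+ (i - j) * 'X^11 ^+ j *+ 'C(i, j))
  = (((c ^+ 11) ^+ (i - j) *+ 'C(i, j)) *: (T i \Po ('X + c%:P))) * 'X^11 ^+ j.
  by rewrite -mul_polyC polyCMn (polyC_exp (i - j)) !mulrnAl mulrnAr mulrCA mulrA.
apply: cartier_nullMXn.
  apply: leq_trans (size_scale_leq _ _) _.
  by rewrite size_comp_poly2 ?sT // size_XaddC.
by have := ltn_ord i; have := ltn_ord j; lia.
Qed.

(** The allowed exponents are symmetric under n -> 50 - n. *)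
Lemma cartier_null_recip (F : {poly k}) : (size F <= 51)%N -> cartier_null F -> cartier_null (recip 50 F).
Proof.
move=> sF hF n nok; rewrite coef_recip; case: leqP => // le_n; apply: hF.
by apply: contra nok; rewrite /exponent_allowed; lia.
Qed.

(** Degree 9 means a simple root at infinity; the simple root a is moved to 0. *)
Lemma nonic_absurd (f : {poly k}) a : (size f <= 10)%N -> f`_9 != 0 ->
  root f a -> ~~ root f^`() a -> cartier_null (f ^+ 5) -> False.
Proof.
move=> sf f9 fa f'a hf.
pose f1 := f \Po ('X + a%:P).
have s1 : size f1 = size f by rewrite size_comp_poly2 // size_XaddC.
have sE : size f = 10%N.
  apply/eqP; rewrite eqn_leq sf ltnNge; apply: contra f9 => s9.
  by rewrite nth_default.
have r1 : root f1 0 by rewrite rootE horner_comp !hornerE.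
have [g gE] := factor_theorem _ _ r1; rewrite subr0 in gE.
have f1g i : f1`_i.+1 = g`_i by rewrite gE coefMX.
have hf1 : cartier_null (f1 ^+ 5) by rewrite -rmorphXn; apply: cartier_null_translate.
have f5 i : (g ^+ 5)`_i = (f1 ^+ 5)`_(5 + i) by rewrite gE exprMn coefMXn addKn.
apply: (@octic_fifth_power_absurd _ e11 g).
- have g_neq0 : g != 0 by apply: contra_eqN (s1) => /eqP g0; rewrite gE g0 mul0r size_poly0 sE.
  by have := s1; rewrite gE size_mulX // sE => - [->].
- rewrite -f1g -[_`_1]mulr1n -coef_deriv -horner_coef0 deriv_comp hornerM.
  by rewrite horner_comp derivD derivX derivC !hornerE.
- rewrite -f1g; have := @lead_coef_comp _ f ('X + a%:P).
  rewrite size_XaddC => /(_ isT); rewrite -/f1 !lead_coefE s1 sE /= => ->.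
  by rewrite size_XaddC /= coefD coefX coefC /= addr0 expr1n mulr1.
- by move=> n n4; rewrite f5 hf1 // /exponent_allowed; lia.
- by move=> n n4; rewrite f5 hf1 // /exponent_allowed; lia.
- by rewrite f5 hf1.
- by rewrite f5 hf1.
Qed.

(** In degree 10 a root of f is moved to infinity by a translation and an inversion;
    another root, moved to b by the translation, becomes the simple root 1/b. *)
Lemma genus4_absurd (f : {poly k}) : (size f <= 11)%N -> (f`_9 != 0) || (f`_10 != 0) ->
  (forall a, root f a -> ~~ root f^`() a) -> cartier_null (f ^+ 5) -> False.
Proof.
move=> sf lead sqf hf.
have hroot (p : {poly k}) : (1 < size p)%N -> exists a, root p a.
  by move=> h; apply/closed_rootP; rewrite gtn_eqF.
have [f10|f10] := eqVneq f`_10 0.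
  rewrite f10 eqxx orbF in lead.
  have s10 : (size f <= 10)%N.
    apply/leq_sizeP => j; rewrite leq_eqVlt => /orP[/eqP<-//|hj].
    by rewrite nth_default // (leq_trans sf).
  have [a fa] : exists a, root f a.
    apply: hroot; rewrite ltnNge; apply: contra lead => s1.
    by rewrite nth_default // (leq_trans s1).
  exact: nonic_absurd s10 lead fa (sqf a fa) hf.
have sE : size f = 11%N.
  apply/eqP; rewrite eqn_leq sf ltnNge; apply: contra f10 => s9.
  by rewrite nth_default.
have [a fa] : exists a, root f a by apply: hroot; rewrite sE.
pose f1 := f \Po ('X + a%:P).
have s1 : size f1 = 11%N by rewrite size_comp_poly2 // size_XaddC.
have r1 : root f1 0 by rewrite rootE horner_comp !hornerE.
have d1 x : f1^`().[x] = f^`().[x + a].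
  by rewrite deriv_comp hornerM horner_comp derivD derivX derivC !hornerE.
have [h hE] := factor_theorem _ _ r1; rewrite subr0 in hE.
have h_neq0 : h != 0 by apply: contra_eqN (s1) => /eqP h0; rewrite hE h0 mul0r size_poly0.
have sh : size h = 10%N by have := s1; rewrite hE size_mulX // => - [].
have f11 : f1`_1 != 0.
  by rewrite -[_`_1]mulr1n -coef_deriv -horner_coef0 d1 add0r; apply: sqf.
have h0 : h`_0 != 0 by move: f11; rewrite hE coefMX.
have [b hb] : exists b, root h b by apply: hroot; rewrite sh.
have nb : b != 0 by apply: contraNneq h0 => b0; move: hb; rewrite b0 rootE horner_coef0.
have f1b : root f1 b by rewrite hE rootM hb.
have d1b : f1^`().[b] != 0.
  by rewrite d1; apply: sqf; move: f1b; rewrite !rootE horner_comp !hornerE.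
have [q qE] := factor_theorem _ _ f1b.
have qb : q.[b] != 0.
  by move: d1b; rewrite qE derivM !hornerE derivXsubC !hornerE subrr mulr0 ?add0r ?addr0 ?mulr1.
have sq : size q = 10%N.
  have q0 : q != 0 by apply: contra_neq qb => ->; rewrite horner0.
  by have := s1; rewrite qE size_mul ?polyXsubC_eq0 // size_XsubC addn2 => - [].
pose r := recip 10 f1.
have rE : r = recip 9 q * recip 1 ('X - b%:P).
  by rewrite /r qE -recipM ?size_XsubC ?sq.
have r1E : recip 1 ('X - b%:P) = 1 - b *: 'X.
  apply/polyP=> i; rewrite coef_recip !coefE.
  case: i => [|[|i]] //=; rewrite ?subnn ?mulr0 ?mulr1 ?subr0 ?sub0r //.
have nbi : b^-1 != 0 by rewrite invr_eq0.
have z1 : (1 - b *: 'X).[b^-1] = 0 by rewrite !hornerE divff // subrr.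
apply: (@nonic_absurd r b^-1).
- apply/leq_sizeP => j; rewrite leq_eqVlt => /orP[/eqP<-|hj]; rewrite coef_recip.
    by rewrite -horner_coef0; apply/eqP.
  by rewrite leqNgt hj.
- by rewrite coef_recip.
- by rewrite rE r1E rootE hornerM z1 mulr0.
- rewrite rE r1E rootE derivM hornerD !hornerM z1 mulr0 add0r.
  rewrite horner_recip ?sq // invrK derivB derivZ derivX derivC.
  by rewrite !hornerE !mulf_neq0 ?oppr_eq0 ?expf_neq0.
- rewrite /r -recipX ?s1 //; apply: cartier_null_recip.
    by apply: (@size_expn_leq _ 10); rewrite s1.
  by rewrite -rmorphXn; apply: cartier_null_translate.
Qed.
End Reduction.

(** * Open sets and regular functions of varieties *)

Lemma predext (T : Type) (A B : T -> Prop) : (forall x, A x <-> B x) -> A = B.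
Proof. by move=> h; apply: functional_extensionality => x; apply: propositional_extensionality. Qed.

Section Lawful.
Variable k : closedFieldType.

(** What is used of a variety: the open sets form a topology, and the regular
    functions a sheaf of rings containing the inverses of nowhere vanishing
    functions.  Only open sets are mentioned, since an isomorphism carries over
    nothing else. *)
Record lawful (X : fun_space k) : Prop := Lawful {
  opnT : opn (fun _ : X => True);
  opnI : forall U V : X -> Prop, opn U -> opn V -> opn (fun x => U x /\ V x);
  opn_local : forall U : X -> Prop,
    (forall x, U x -> exists V : X -> Prop, [/\ opn V, V x & forall y, V y -> U y]) -> opn U;
  reg_local : forall (U : X -> Prop) (f : X -> k), opn U ->
    (forall x, U x -> exists (V : X -> Prop) (g : X -> k),
        [/\ opn V, V x, reg V g & forall y, U y -> V y -> f y = g y]) -> reg U f;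
  reg_cst : forall (U : X -> Prop) (c : k), opn U -> reg U (fun _ => c);
  regD : forall (U : X -> Prop) (f g : X -> k), opn U ->
    reg U f -> reg U g -> reg U (fun x => f x + g x);
  regM : forall (U : X -> Prop) (f g : X -> k), opn U ->
    reg U f -> reg U g -> reg U (fun x => f x * g x);
  opn_neq0 : forall (U : X -> Prop) (f : X -> k), opn U -> reg U f ->
    opn (fun x => U x /\ f x != 0);
  regV : forall (U : X -> Prop) (f : X -> k), opn U -> reg U f ->
    (forall x, U x -> f x != 0) -> reg U (fun x => (f x)^-1) }.

Lemma reg_sub (X : fun_space k) (U V : X -> Prop) f : lawful X -> opn U ->
  opn V -> reg U f -> (forall x, V x -> U x) -> reg V f.
Proof. by move=> lX oU oV rU VU; apply: (reg_local lX oV) => x Vx; exists U, f; split => //; exact: VU. Qed.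

Lemma reg_eq (X : fun_space k) (U : X -> Prop) f g : lawful X -> opn U ->
  reg U f -> (forall x, U x -> g x = f x) -> reg U g.
Proof. by move=> lX oU rU fg; apply: (reg_local lX oU) => x Ux; exists U, f; split => // y Uy _; exact: fg. Qed.

Section Quotient.
Variables (T : Type) (forms : nat -> (T -> k) -> Prop).
Hypothesis form_cst : forall c, forms 0 (fun _ => c).
Hypothesis formD : forall d f g, forms d f -> forms d g -> forms d (fun x => f x + g x).
Hypothesis formM : forall d e f g, forms d f -> forms e g -> forms (d + e)%N (fun x => f x * g x).
Let X := @quotient_space k T forms.

Lemma quotient_opnP (U : X -> Prop) : opn U <->
  forall x, U x -> exists d f, [/\ forms d f, f x != 0 & forall y, f y != 0 -> U y].
Proof.
split=> [[S [hS hU]] x /hU[f Sf fx]|h].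
  have [d fd] := hS f Sf; exists d, f; split => // y fy; apply/hU; by exists f.
exists (fun f => (exists d, forms d f) /\ forall y, f y != 0 -> U y); split=> [f []//|x].
split=> [/h[d [f [fd fx fU]]]|[f [_ fU] /fU//]].
by exists f => //; split => //; exists d.
Qed.

(** Fractions of forms are added, multiplied and inverted as usual. *)
Lemma lawful_quotient : lawful X.
Proof.
have oI (U V : X -> Prop) : opn U -> opn V -> opn (fun x => U x /\ V x).
  move=> /quotient_opnP oU /quotient_opnP oV; apply/quotient_opnP => x [/oU[d [f [fd fx fU]]] /oV[e [g [ge gx gV]]]].
  exists (d + e)%N, (fun x => f x * g x); split; [exact: formM|exact: mulf_neq0|].
  move=> y; rewrite mulf_eq0 negb_or => /andP[/fU ? /gV ?]; split => //.
have oT : opn (fun _ : X => True).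
  by apply/quotient_opnP => x _; exists 0%N, (fun _ => 1); split => //; exact: oner_neq0.
split => //.
- move=> U h; apply/quotient_opnP => x /h[V [/quotient_opnP oV Vx VU]].
  by have [d [f [? ? fV]]] := oV x Vx; exists d, f; split => // y /fV /VU.
- move=> U f _ h /= x Ux; have [V [g [oV Vx rg fg]]] := h x Ux.
  have [V' [d [a [b [oV' V'x fa fb hab]]]]] := rg x Vx.
  exists (fun y => V y /\ V' y), d, a, b; split => //; first exact: oI.
  move=> y Uy [Vy V'y].
  by rewrite fg //; exact: hab.
- move=> U c _ /= x Ux; exists (fun _ => True), 0%N, (fun _ => c), (fun _ => 1); split => // y _ _.
  by rewrite oner_neq0 divr1.
- move=> U f g oU rf rg /= x Ux.
  have [V [d [a [b [oV Vx fa fb hab]]]]] := rf x Ux.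
  have [V' [d' [a' [b' [oV' V'x fa' fb' hab']]]]] := rg x Ux.
  exists (fun y => V y /\ V' y), (d + d')%N, (fun x => a x * b' x + b x * a' x),
    (fun x => b x * b' x); split; [exact: oI|by []|by apply: formD; exact: formM|exact: formM|].
  move=> y Uy [Vy V'y]; have [nb ->] := hab y Uy Vy; have [nb' ->] := hab' y Uy V'y.
  by rewrite mulf_neq0 //; split => //; field; rewrite nb nb'.
- move=> U f g oU rf rg /= x Ux.
  have [V [d [a [b [oV Vx fa fb hab]]]]] := rf x Ux.
  have [V' [d' [a' [b' [oV' V'x fa' fb' hab']]]]] := rg x Ux.
  exists (fun y => V y /\ V' y), (d + d')%N, (fun x => a x * a' x),
    (fun x => b x * b' x); split; [exact: oI|by []|exact: formM|exact: formM|].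
  move=> y Uy [Vy V'y]; have [nb ->] := hab y Uy Vy; have [nb' ->] := hab' y Uy V'y.
  by rewrite mulf_neq0 //; split => //; field; rewrite nb nb'.
- move=> U f oU rf; apply/quotient_opnP => x [Ux fx].
  have [V [d [a [b [oV Vx fa fb hab]]]]] := rf x Ux.
  have/quotient_opnP/(_ x (conj Ux Vx))[e [u [fu ux uUV]]] := oI _ _ oU oV.
  exists (d + e)%N, (fun y => a y * u y); split; first exact: formM.
    have [nb fE] := hab x Ux Vx; rewrite mulf_neq0 //.
    by apply: contraNneq fx => a0; rewrite fE a0 mul0r.
  move=> y; rewrite mulf_eq0 negb_or => /andP[ay /uUV[Uy Vy]]; split => //.
  by have [nb ->] := hab y Uy Vy; rewrite mulf_neq0 // invr_eq0.
- move=> U f oU rf nf /= x Ux.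
  have [V [d [a [b [oV Vx fa fb hab]]]]] := rf x Ux.
  exists V, d, b, a; split => // y Uy Vy; have [nb fE] := hab y Uy Vy.
  split; last by rewrite fE invf_div.
  by have := nf y Uy; rewrite fE; apply: contraNneq => ->; rewrite mul0r.
Qed.
End Quotient.

Lemma lawful_affine m : lawful (affine_space k m).
Proof.
apply: lawful_quotient.
- by move=> c; exists c%:MP => x; rewrite mevalC.
- by move=> _ f g [F hF] [G hG]; exists (F + G) => x; rewrite mevalD hF hG.
- by move=> _ _ f g [F hF] [G hG]; exists (F * G) => x; rewrite mevalM hF hG.
Qed.

Lemma lawful_proj n : lawful (proj_space k n).
Proof.
apply: lawful_quotient.
- move=> c; exists c%:MP => [|x]; last by rewrite mevalC.
  by rewrite -[c%:MP]mulr1 mul_mpolyC dhomogZ // dhomog1.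
- by move=> d f g [F hF1 hF] [G hG1 hG]; exists (F + G) => [|x]; rewrite ?dhomogD // mevalD hF hG.
- by move=> d e f g [F hF1 hF] [G hG1 hG]; exists (F * G) => [|x]; rewrite ?dhomogM // mevalM hF hG.
Qed.

Lemma lawful_sub (X : fun_space k) (Z : X -> Prop) : lawful X -> lawful (sub_space Z).
Proof.
move=> lX.
have oI (U V : sub_space Z -> Prop) : opn U -> opn V -> opn (fun x => U x /\ V x).
  move=> [U' oU hU] [V' oV hV]; exists (fun x => U' x /\ V' x); first exact: opnI.
  by move=> x; rewrite hU hV.
split => //.
- by exists (fun _ => True) => //; exact: opnT.
- move=> U h.
  exists (fun x => exists V : X -> Prop, [/\ opn V, V x & forall y : sub_space Z, V (sval y) -> U y]).
    apply: (opn_local lX) => x [V [oV Vx VU]]; exists V; split => // y Vy; by exists V.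
  move=> x; split=> [/h[V [[V' oV' hV] Vx VU]]|[V [oV Vx VU]]]; last exact: VU.
  exists V'; split => //; first exact/hV.
  by move=> y /hV /VU.
- move=> U f _ h x Ux; have [V [g [[W oW hW] Vx rg fg]]] := h x Ux.
  have [V' [g' [oV' V'x rg' gg']]] := rg x Vx.
  exists (fun y => V' y /\ W y), g'; split; [exact: opnI|by split => //; apply/hW| |].
    by apply: (reg_sub lX oV' _ rg') => [|y []//]; exact: opnI.
  by move=> y Uy [V'y /hW Vy]; rewrite fg // gg'.
- move=> U c _ x Ux; exists (fun _ => True), (fun _ => c); split => //; [exact: opnT|exact: (reg_cst lX _ (opnT lX))].
- move=> U f g oU rf rg x Ux.
  have [V [f' [oV Vx rf' ff']]] := rf x Ux; have [V' [g' [oV' V'x rg' gg']]] := rg x Ux.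
  have oVV := opnI lX oV oV'.
  exists (fun y => V y /\ V' y), (fun x => f' x + g' x); split => //.
    by apply: (regD lX) => //; [apply: (reg_sub lX oV oVV rf') => y []|apply: (reg_sub lX oV' oVV rg') => y []].
  by move=> y Uy [? ?]; rewrite ff' // gg'.
- move=> U f g oU rf rg x Ux.
  have [V [f' [oV Vx rf' ff']]] := rf x Ux; have [V' [g' [oV' V'x rg' gg']]] := rg x Ux.
  have oVV := opnI lX oV oV'.
  exists (fun y => V y /\ V' y), (fun x => f' x * g' x); split => //.
    by apply: (regM lX) => //; [apply: (reg_sub lX oV oVV rf') => y []|apply: (reg_sub lX oV' oVV rg') => y []].
  by move=> y Uy [? ?]; rewrite ff' // gg'.
- move=> U f [U' oU hU] rf.
  exists (fun x => exists V : X -> Prop, [/\ opn V, V x & forall y : sub_space Z, V (sval y) -> U y /\ f y != 0]).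
    apply: (opn_local lX) => x [V [oV Vx VU]]; exists V; split => // y Vy; by exists V.
  move=> x; split=> [[Ux fx]|[V [oV Vx VU]]]; last exact: VU.
  have [V [f' [oV Vx rf' ff']]] := rf x Ux.
  have oVf := opnI lX oU (opn_neq0 lX oV rf').
  eexists; split; first exact: oVf; first by rewrite /= -ff' //; split => //; apply/hU.
  by move=> y [/hU Uy [Vy fy]]; rewrite ff'.
- move=> U f oU rf nf x Ux; have [V [f' [oV Vx rf' ff']]] := rf x Ux.
  have oVf := opn_neq0 lX oV rf'.
  exists (fun y => V y /\ f' y != 0), (fun y => (f' y)^-1); split => //.
  + by split => //; rewrite -ff' // nf.
  + by apply: (regV lX) => // [|y []//]; apply: (reg_sub lX oV oVf rf') => y [].
  + by move=> y Uy [Vy _]; rewrite ff'.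
Qed.

Lemma lawful_iso (X Y : fun_space k) : isomorphic X Y -> lawful Y -> lawful X.
Proof.
move=> [phi [psi [mphi mpsi phiK psiK]]] lY.
have pull (A : Type) (F : X -> A) : (fun x => F (psi (phi x))) = F.
  by apply: functional_extensionality => x; rewrite phiK.
have oE (U : X -> Prop) : opn (fun y => U (psi y)) -> opn U.
  by move=> /mphi[]; rewrite pull.
have rE (U : X -> Prop) f : opn (fun y => U (psi y)) -> reg (fun y => U (psi y)) (fun y => f (psi y)) -> reg U f.
  by move=> /mphi[_ h] /h; rewrite !pull.
have oP (U : X -> Prop) : opn U -> opn (fun y => U (psi y)) by case/mpsi.
have rP (U : X -> Prop) f : opn U -> reg U f -> reg (fun y => U (psi y)) (fun y => f (psi y)).
  by case/mpsi => _; apply.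
split.
- by apply: oE; exact: opnT.
- by move=> U V /oP oU /oP oV; apply: oE; apply: (opnI lY oU oV).
- move=> U h; apply: oE; apply: (opn_local lY) => y /h[V [/oP oV Vy VU]].
  by exists (fun y => V (psi y)); split => // z; exact: VU.
- move=> U f /oP oU h; apply: rE => //; apply: (reg_local lY oU) => y /h[V [g [oV Vy rg fg]]].
  by exists (fun y => V (psi y)), (fun y => g (psi y)); split => // [||z]; [exact: oP|exact: rP|exact: fg].
- by move=> U c /oP oU; apply: rE => //; exact: (reg_cst lY).
- by move=> U f g oU /(rP _ _ oU) rf /(rP _ _ oU) rg; apply: rE; [exact: oP|apply: (regD lY (oP _ oU) rf rg)].
- by move=> U f g oU /(rP _ _ oU) rf /(rP _ _ oU) rg; apply: rE; [exact: oP|apply: (regM lY (oP _ oU) rf rg)].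
- by move=> U f oU /(rP _ _ oU) rf; apply: oE; apply: (opn_neq0 lY (oP _ oU) rf).
- move=> U f oU /(rP _ _ oU) rf nf; apply: rE; first exact: oP.
  by apply: (regV lY (oP _ oU) rf) => y; exact: nf.
Qed.

Lemma lawful_projective X : projective X -> lawful X.
Proof. by case=> n [Z [_ /lawful_iso]]; apply; apply/lawful_sub/lawful_proj. Qed.
End Lawful.

(** * Rational functions on an irreducible variety *)

Section Integral.
Variables (k : closedFieldType) (X : fun_space k).
Hypothesis lX : lawful X.
Hypothesis iX : irreducible X.
Implicit Types (U V W : X -> Prop) (f g : X -> k) (P Q : X) (p : {poly k}).

Lemma opn_meet U V : opn U -> nonempty U -> opn V -> nonempty V ->
  nonempty (fun x => U x /\ V x).
Proof.
move=> oU [a Ua] oV [b Vb]; apply: NNPP => h; case: iX => _ irr.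
have cl W : opn W -> closed (fun x => ~ W x).
  move=> oW; rewrite /closed (_ : (fun x => _) = W) //.
  by apply: predext => x; split=> [/NNPP//|Wx]; apply.
case: (irr (fun x => ~ U x) (fun x => ~ V x)); [exact: cl|exact: cl| |by move/(_ a)|by move/(_ b)].
move=> x; apply: NNPP => /not_or_and[/NNPP Ux /NNPP Vx]; apply: h; by exists x.
Qed.

(** Holding on a nonempty open set: properties of the generic point. *)
Definition generic (A : X -> Prop) : Prop :=
  exists O : X -> Prop, [/\ opn O, nonempty O & forall x, O x -> A x].

Lemma generic_opn U : opn U -> nonempty U -> generic U.
Proof. by exists U. Qed.

Lemma genericT (A : X -> Prop) : (forall x, A x) -> generic A.
Proof. by move=> h; exists (fun _ => True); split => //; [exact: opnT|case: iX => [[x _] _]; exists x]. Qed.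

Lemma generic2 (A B C : X -> Prop) : (forall x, A x -> B x -> C x) ->
  generic A -> generic B -> generic C.
Proof.
move=> h [O [oO nO OA]] [O' [oO' nO' OB]]; exists (fun x => O x /\ O' x).
by split; [exact: opnI|exact: opn_meet|move=> x [/OA ? /OB ?]; exact: h].
Qed.

Lemma generic1 (A B : X -> Prop) : (forall x, A x -> B x) -> generic A -> generic B.
Proof. by move=> h [O [oO nO OA]]; exists O; split => // x /OA; exact: h. Qed.

Lemma generic3 (A B C D : X -> Prop) : (forall x, A x -> B x -> C x -> D x) ->
  generic A -> generic B -> generic C -> generic D.
Proof.
move=> h gA gB; apply: generic2 (generic2 (fun x a b => conj a b) gA gB).
by move=> x []; exact: h.
Qed.

Lemma generic_ex (A : X -> Prop) : generic A -> exists x, A x.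
Proof. by move=> [O [_ [x Ox] OA]]; exists x; exact: OA. Qed.

Lemma generic_all n (A : 'I_n -> X -> Prop) :
  (forall i, generic (A i)) -> generic (fun x => forall i, A i x).
Proof.
move=> h; suff: generic (fun x => forall i, i \in enum 'I_n -> A i x).
  by apply: generic1 => x hx i; apply: hx; rewrite mem_enum.
elim: (enum 'I_n) => [|i s IH]; first by apply: genericT => x i.
apply: generic2 (h i) IH => x Ai IHx j; rewrite inE => /orP[/eqP->//|]; exact: IHx.
Qed.

Lemma regN U f : opn U -> reg U f -> reg U (fun x => - f x).
Proof.
move=> oU rf; apply: (reg_eq lX oU (regM lX oU (reg_cst lX (-1) oU) rf)) => x _.
by rewrite mulN1r.
Qed.

Lemma regB U f g : opn U -> reg U f -> reg U g -> reg U (fun x => f x - g x).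
Proof. by move=> oU rf rg; apply: (regD lX) => //; exact: regN. Qed.

Lemma reg_exp U f n : opn U -> reg U f -> reg U (fun x => f x ^+ n).
Proof.
move=> oU rf; elim: n => [|n IH]; first by apply: (reg_eq lX oU (reg_cst lX 1 oU)).
by apply: (reg_eq lX oU (regM lX oU rf IH)) => x _; rewrite exprS.
Qed.

Lemma reg_sum U (I : Type) (r : seq I) (f : I -> X -> k) : opn U ->
  (forall i, reg U (f i)) -> reg U (fun x => \sum_(i <- r) f i x).
Proof.
move=> oU rf; elim: r => [|i r IH].
  by apply: (reg_eq lX oU (reg_cst lX 0 oU)) => x _; rewrite big_nil.
by apply: (reg_eq lX oU (regD lX oU (rf i) IH)) => x _; rewrite big_cons.
Qed.

Lemma reg_poly U f p : opn U -> reg U f -> reg U (fun x => p.[f x]).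
Proof.
move=> oU rf; apply: (@reg_eq _ _ U (fun x => \sum_(i <- enum 'I_(size p)) p`_i * f x ^+ i)) => //.
  apply: reg_sum => // i; apply: (regM lX) => //; first exact: reg_cst.
  exact: reg_exp.
by move=> x _; rewrite horner_coef big_enum.
Qed.

Lemma reg_generic U f g : opn U -> reg U f -> reg U g ->
  generic (fun x => f x = g x) -> forall x, U x -> f x = g x.
Proof.
move=> oU rf rg [O [oO nO fg]] x Ux; apply: NNPP => nfg.
have oN := opn_neq0 lX oU (regB oU rf rg).
case: (opn_meet oN _ oO nO); first by exists x; rewrite subr_eq0; split => //; apply/eqP.
by move=> y [[_ /eqP ny] /fg e]; apply: ny; rewrite e subrr.
Qed.

(** The rational function [r] is regular at [P], up to its values outside
    a nonempty open set. *)
Definition ext P (r : X -> k) : Prop := exists W g,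
  [/\ opn W, W P, reg W g & generic (fun x => r x = g x)].

Lemma ext_reg W g P : opn W -> W P -> reg W g -> ext P g.
Proof. by move=> oW WP rg; exists W, g; split => //; apply: genericT. Qed.

Lemma ext_generic P r s : generic (fun x => s x = r x) -> ext P r -> ext P s.
Proof.
move=> rs [W [g [oW WP rg e]]]; exists W, g; split => //.
by apply: generic2 rs e => x -> ->.
Qed.

Lemma ext_cst P c : ext P (fun _ => c).
Proof. by apply: (ext_reg (opnT lX)) => //; exact: (reg_cst lX _ (opnT lX)). Qed.

Lemma extD P r s : ext P r -> ext P s -> ext P (fun x => r x + s x).
Proof.
move=> [W [g [oW WP rg e]]] [W' [g' [oW' WP' rg' e']]].
have oI := opnI lX oW oW'.
exists (fun x => W x /\ W' x), (fun x => g x + g' x); split => //.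
  by apply: (regD lX) => //; [apply: (reg_sub lX oW) => // x []|apply: (reg_sub lX oW') => // x []].
by apply: generic2 e e' => x -> ->.
Qed.

Lemma extM P r s : ext P r -> ext P s -> ext P (fun x => r x * s x).
Proof.
move=> [W [g [oW WP rg e]]] [W' [g' [oW' WP' rg' e']]].
have oI := opnI lX oW oW'.
exists (fun x => W x /\ W' x), (fun x => g x * g' x); split => //.
  by apply: (regM lX) => //; [apply: (reg_sub lX oW) => // x []|apply: (reg_sub lX oW') => // x []].
by apply: generic2 e e' => x -> ->.
Qed.

Lemma extN P r : ext P r -> ext P (fun x => - r x).
Proof.
move=> er; apply: ext_generic (extM (ext_cst P (-1)) er).
by apply: genericT => x; rewrite mulN1r.
Qed.

Lemma extB P r s : ext P r -> ext P s -> ext P (fun x => r x - s x).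
Proof. by move=> er es; apply: extD => //; exact: extN. Qed.

Lemma extX P r n : ext P r -> ext P (fun x => r x ^+ n).
Proof.
move=> er; elim: n => [|n IH]; first by apply: ext_generic (ext_cst P 1); apply: genericT.
by apply: ext_generic (extM er IH); apply: genericT => x; rewrite exprS.
Qed.

Lemma ext_sum P (I : Type) (s : seq I) (r : I -> X -> k) :
  (forall i, ext P (r i)) -> ext P (fun x => \sum_(i <- s) r i x).
Proof.
move=> er; elim: s => [|i s IH].
  by apply: ext_generic (ext_cst P 0); apply: genericT => x; rewrite big_nil.
by apply: ext_generic (extD (er i) IH); apply: genericT => x; rewrite big_cons.
Qed.

Lemma ext_poly P r p : ext P r -> ext P (fun x => p.[r x]).
Proof.
move=> er; apply: (@ext_generic _ (fun x => \sum_(i <- enum 'I_(size p)) p`_i * r x ^+ i)).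
  by apply: genericT => x; rewrite horner_coef big_enum.
by apply: ext_sum => i; apply: extM; [exact: ext_cst|exact: extX].
Qed.

Lemma ext_inv W g P : opn W -> W P -> reg W g -> g P != 0 -> ext P (fun x => (g x)^-1).
Proof.
move=> oW WP rg gP; have oN := opn_neq0 lX oW rg.
apply: (ext_reg oN) => //; apply: (regV lX) => // [|x []//].
by apply: (reg_sub lX oW) => // x [].
Qed.

(** The values on the various neighbourhoods agree because they agree generically,
    so that they form one function, locally regular. *)
Lemma ext_glue U r : opn U -> nonempty U -> (forall P, U P -> ext P r) ->
  exists g, reg U g /\ generic (fun x => r x = g x).
Proof.
move=> oU [P0 UP0] er.
pose val P v := exists W g, [/\ opn W, W P, reg W g, generic (fun x => r x = g x) & v = g P].
pose g P := epsilon (inhabits 0) (val P).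
have gE W h P : opn W -> W P -> reg W h -> generic (fun x => r x = h x) -> g P = h P.
  move=> oW WP rh e.
  have [W' [h' [oW' WP' rh' e' ->]]] : val P (g P).
    by apply: epsilon_spec; exists (h P), W, h.
  have oI := opnI lX oW oW'.
  apply: (reg_generic oI _ _ _ (conj WP WP')).
  - by apply: (reg_sub lX oW') => // x [].
  - by apply: (reg_sub lX oW) => // x [].
  - by apply: generic2 e e' => x -> ->.
exists g; split.
  apply: (reg_local lX oU) => P /er[W [h [oW WP rh e]]]; exists W, h; split => //.
  by move=> Q _ WQ; exact: (gE W).
have [W [h [oW WP rh e]]] := er P0 UP0.
apply: generic2 (generic_opn oW (ex_intro _ P0 WP)) (e) => x Wx ->.
by symmetry; exact: (gE W h x oW Wx rh e).
Qed.
End Integral.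

(** * Double covers of the affine line *)

(** Well-ordering of nat for predicates that need not be decidable. *)
Lemma ex_min (Pr : nat -> Prop) : (exists n, Pr n) ->
  exists n, Pr n /\ forall m, Pr m -> (n <= m)%N.
Proof.
case=> n; elim: n {-2}n (leqnn n) => [|n IH] m le_mn Pm.
  by exists m; split => // i _; move: le_mn; rewrite leqn0 => /eqP->.
have [[i [Pi lt_im]]|nex] := classic (exists i, Pr i /\ (i < m)%N).
  by apply: (IH i) => //; rewrite -ltnS (leq_trans lt_im).
exists m; split => // i Pi; rewrite leqNgt; apply/negP => lt_im; apply: nex; by exists i.
Qed.

(** After division by the greatest common divisor, all powers of a' divide D, so
    that a' is constant. *)
Lemma dvdp_of_pow (F : fieldType) (D a b : {poly F}) : D != 0 -> a != 0 ->
  (forall i, a ^+ i %| D * b ^+ i) -> a %| b.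
Proof.
move=> D0 a0 h; set g := gcdp a b.
have g0 : g != 0 by rewrite gcdp_eq0 negb_and a0.
pose a' := a %/ g; pose b' := b %/ g.
have aE : a = a' * g by rewrite divpK // dvdp_gcdl.
have bE : b = b' * g by rewrite divpK // dvdp_gcdr.
have cop : coprimep a' b' by apply: coprimep_div_gcd; rewrite a0.
have a'0 : a' != 0 by apply: contraNneq a0 => e; rewrite aE e mul0r.
have hi i : a' ^+ i %| D.
  have := h i; rewrite {1}aE bE !exprMn mulrA dvdp_mul2r ?expf_neq0 //.
  by rewrite Gauss_dvdpl // coprimep_expl // coprimep_expr.
suff s1 : size a' = 1%N.
  have a1 : a' %= 1 by rewrite -size_poly_eq1 s1.
  by rewrite aE bE dvdp_mul2r // (eqp_dvdl _ a1) dvd1p.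
apply/eqP; rewrite eqn_leq size_poly_gt0 a'0 andbT leqNgt; apply/negP => s2.
have := dvdp_leq D0 (hi (size D)); rewrite leqNgt => /negP; apply.
rewrite -[X in (_ < X)%N]prednK ?size_poly_gt0 ?expf_neq0 // ltnS size_exp.
by rewrite leq_pmull //; case: (size a') s2 => [|[]].
Qed.

Section Chart.
Variables (k : closedFieldType) (X : fun_space k).
Hypothesis lX : lawful X.
Hypothesis iX : irreducible X.
Hypothesis two_neq0 : 2%:R != 0 :> k.
Implicit Types (V W : X -> Prop) (f g w : X -> k) (P Q : X) (p q n : {poly k}).

(** Local rings of [U] are localizations of the ring of functions on [U]. *)
Definition localizes (U : X -> Prop) := forall W f P, opn W -> W P -> U P -> reg W f ->
  exists a b, [/\ reg U a, reg U b, b P != 0 &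
    forall y, U y -> b y != 0 -> W y /\ f y = a y / b y].

(** An open set that is finite of degree 2 over the affine line with coordinate
    [x]: [ch_fin] is finiteness, [ch_dep] and [ch_indep] say that the rank over
    k(x) is at most 2 and at least 2. *)
Record chart (U : X -> Prop) (x : X -> k) : Prop := Chart {
  ch_opn : opn U;
  ch_reg : reg U x;
  ch_loc : localizes U;
  ch_dom : forall p, p != 0 -> exists P, U P /\ p.[x P] != 0;
  ch_fin : exists r (a : 'I_r -> X -> k), (forall i, reg U (a i)) /\
    forall w, reg U w -> exists b : 'I_r -> {poly k},
      forall P, U P -> w P = \sum_(i < r) (b i).[x P] * a i P;
  ch_dep : forall w0 w1 w2, reg U w0 -> reg U w1 -> reg U w2 ->
    exists p0 p1 p2, ~ [/\ p0 = 0, p1 = 0 & p2 = 0] /\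
      forall P, U P -> p0.[x P] * w0 P + p1.[x P] * w1 P + p2.[x P] * w2 P = 0;
  ch_indep : exists w, reg U w /\
    forall n p, (forall P, U P -> n.[x P] * w P = p.[x P]) -> n = 0;
  ch_smooth : forall P, U P -> cotangent_dim P 1 }.

(** The double cover v^2 = f(x) of the affine line, with f squarefree. *)
Record dcover (U : X -> Prop) (x y : X -> k) (f : {poly k}) : Prop := Dcover {
  dc_opn : opn U;
  dc_x : reg U x;
  dc_y : reg U y;
  dc_loc : localizes U;
  dc_dom : forall p, p != 0 -> exists P, U P /\ p.[x P] != 0;
  dc_eq : forall P, U P -> y P ^+ 2 = f.[x P];
  dc_span : forall w, reg U w -> exists p q, forall P, U P -> w P = p.[x P] + q.[x P] * y P;
  dc_free : forall p q, (forall P, U P -> p.[x P] + q.[x P] * y P = 0) -> p = 0 /\ q = 0;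
  dc_sqf : forall a, root f a -> ~~ root f^`() a }.

Section OneChart.
Variables (U : X -> Prop) (x : X -> k).
Hypothesis cU : chart U x.
Let oU := ch_opn cU.
Let rx := ch_reg cU.

Let rp p : reg U (fun P => p.[x P]).
Proof. exact: reg_poly. Qed.

Lemma chart_poly_eq0 p : (forall P, U P -> p.[x P] = 0) -> p = 0.
Proof.
move=> h; apply/eqP; apply: contraT => /(ch_dom cU)[P [UP]].
by rewrite h // eqxx.
Qed.

Lemma chart_generic p : p != 0 -> generic (fun P => U P /\ p.[x P] != 0).
Proof.
move=> /(ch_dom cU)[P [UP pP]]; exists (fun P => U P /\ p.[x P] != 0).
by split => //; [exact: opn_neq0|exists P].
Qed.

Lemma chart_cancel p w w' : p != 0 -> reg U w -> reg U w' ->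
  (forall P, U P -> p.[x P] * w P = p.[x P] * w' P) -> forall P, U P -> w P = w' P.
Proof.
move=> p0 rw rw' h; apply: (reg_generic lX iX) => //.
by apply: generic1 (chart_generic p0) => P [UP pP]; apply: (mulfI pP); exact: h.
Qed.

(** Not in k(x). *)
Definition irrational w := forall n p, (forall P, U P -> n.[x P] * w P = p.[x P]) -> n = 0.

Lemma irrational_free w p q : irrational w ->
  (forall P, U P -> p.[x P] + q.[x P] * w P = 0) -> p = 0 /\ q = 0.
Proof.
move=> iw h; have q0 : q = 0.
  by apply: (iw q (- p)) => P UP; rewrite hornerN; apply/eqP; rewrite -addr_eq0 addrC h.
by split => //; apply: chart_poly_eq0 => P UP; rewrite -[RHS](h P UP) q0 horner0 mul0r addr0.
Qed.

Lemma irrational_dep w z : irrational w -> reg U w -> reg U z ->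
  exists n p q, n != 0 /\ forall P, U P -> n.[x P] * z P = p.[x P] + q.[x P] * w P.
Proof.
move=> iw rw rz.
have [p0 [p1 [p2 [nz h]]]] := ch_dep cU (reg_cst lX 1 oU) rw rz.
exists p2, (- p0), (- p1); split; last first.
  move=> P /h; rewrite !hornerN mulr1 => /eqP; rewrite addr_eq0 => /eqP.
  by rewrite mulNr -opprD => ->; rewrite opprK.
apply/eqP => p20; apply: nz.
have [-> ->] : p0 = 0 /\ p1 = 0 by apply: irrational_free iw _ => P /h; rewrite p20 horner0 mul0r addr0 mulr1.
by split.
Qed.

Definition quadratic y (F : {poly k}) :=
  [/\ reg U y, irrational y & forall P, U P -> y P ^+ 2 = F.[x P]].

(** Completing the square in n w^2 = p + q w. *)
Lemma quadratic_exists : exists y F, quadratic y F.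
Proof.
have [w [rw iw]] := ch_indep cU.
have [n [p [q [n0 h]]]] := irrational_dep iw rw (reg_exp lX 2 oU rw).
exists (fun P => (2%:R *: n).[x P] * w P - q.[x P]), (4%:R *: n * p + q ^+ 2); split.
- by apply: regB => //; apply: regM.
- move=> m r e; suff : m * (2%:R *: n) = 0.
    by move/eqP; rewrite mulf_eq0 scaler_eq0 (negPf two_neq0) (negPf n0) !orbF => /eqP.
  apply: (iw _ (r + m * q)) => P UP; have := e P UP; rewrite /= !hornerE => <- /=; ring.
move=> P UP; have e := h P UP; rewrite !hornerE.
have -> : (2%:R * n.[x P] * w P - q.[x P]) ^+ 2 =
   4%:R * n.[x P] * (n.[x P] * w P ^+ 2) - 4%:R * n.[x P] * (q.[x P] * w P) + q.[x P] ^+ 2 by ring.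
by rewrite e; ring.
Qed.

Section Quadratic.
Variables (y : X -> k) (F : {poly k}).
Hypothesis Qy : quadratic y F.
Let ry : reg U y. Proof. by case: Qy. Qed.
Let iy : irrational y. Proof. by case: Qy. Qed.
Let ey P : U P -> y P ^+ 2 = F.[x P]. Proof. by case: Qy => _ _; apply. Qed.

(** The norm of c_1 + c_2 y to k[x]. *)
Definition norm (c : {poly k} * {poly k}) := c.1 ^+ 2 - c.2 ^+ 2 * F.
Definition mulc (c d : {poly k} * {poly k}) :=
  (c.1 * d.1 + c.2 * d.2 * F, c.1 * d.2 + c.2 * d.1).
Definition value (c : {poly k} * {poly k}) P := c.1.[x P] + c.2.[x P] * y P.

Lemma normM c d : norm (mulc c d) = norm c * norm d.
Proof. rewrite /norm /mulc /=; ring. Qed.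

Lemma valueM c d P : U P -> value (mulc c d) P = value c P * value d P.
Proof.
move=> UP; rewrite /value !hornerE -(ey UP); ring.
Qed.

Lemma value_pow c i : exists d, norm d = norm c ^+ i /\
  forall P, U P -> value d P = value c P ^+ i.
Proof.
elim: i => [|i [d [Nd vd]]].
  by exists (1, 0); rewrite /norm /value /=; split=> [|P _]; rewrite ?hornerE expr0; ring.
exists (mulc c d); rewrite normM Nd exprS; split => // P UP.
by rewrite valueM // vd // exprS.
Qed.

Lemma value_inj c d : (forall P, U P -> value c P = value d P) -> c = d.
Proof.
move=> h; case: (@irrational_free y (c.1 - d.1) (c.2 - d.2) iy) => [P UP|].
  rewrite !hornerE; have /eqP := h P UP; rewrite -subr_eq0 => /eqP <-.
  by rewrite /value; ring.
by case: c d {h} => c1 c2 [d1 d2] /= /eqP; rewrite subr_eq0 => /eqP -> /eqP; rewrite subr_eq0 => /eqP ->.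
Qed.

(** Clearing denominators of finitely many generators is enough. *)
Lemma common_denominator : exists2 D, D != 0 &
  forall w, reg U w -> exists c, forall P, U P -> D.[x P] * w P = value c P.
Proof.
have [r [a [ra span]]] := ch_fin cU.
have/fin_all_exists[n hn] i : exists n : {poly k}, n != 0 /\
    exists c, forall P, U P -> n.[x P] * a i P = value c P.
  have [n [p [q [n0 h]]]] := irrational_dep iy ry (ra i).
  by exists n; split => //; exists (p, q).
have/fin_all_exists[c hc] i := (hn i).2.
exists (\prod_i n i); first by apply/prodf_neq0 => i _; have [] := hn i.
move=> w /span[b hb].
pose m i := b i * \prod_(j | j != i) n j.
exists (\sum_i m i * (c i).1, \sum_i m i * (c i).2) => P UP.
rewrite /value /= !horner_sum mulr_suml -big_split /= hb // mulr_sumr.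
apply: eq_bigr => i _; rewrite (bigD1 i) //= /m !hornerM.
have -> : (n i).[x P] * (\prod_(j | j != i) n j).[x P] * ((b i).[x P] * a i P) =
  (b i).[x P] * (\prod_(j | j != i) n j).[x P] * ((n i).[x P] * a i P) by ring.
by rewrite hc // /value; ring.
Qed.

(** With a denominator D common to all w^i, the norms of the (n w)^i are divisible
    by n^(2i) up to the fixed factor D^2. *)
Lemma integral_norm n w c : n != 0 -> reg U w ->
  (forall P, U P -> n.[x P] * w P = value c P) -> n ^+ 2 %| norm c.
Proof.
move=> n0 rw h; have [D D0 hD] := common_denominator.
apply: (@dvdp_of_pow _ (D ^+ 2)); rewrite ?expf_neq0 // => i.
have [e he] := hD _ (reg_exp lX i oU rw).
have [d [Nd vd]] := value_pow c i.
have E : (n ^+ i * e.1, n ^+ i * e.2) = (D * d.1, D * d.2).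
  apply: value_inj => P UP.
  transitivity (n.[x P] ^+ i * value e P); first by rewrite /value !hornerE /=; ring.
  transitivity (D.[x P] * value d P); last by rewrite /value !hornerE /=; ring.
  by rewrite vd // -he // -h // exprMn; ring.
rewrite -Nd; apply/dvdpP; exists (norm e).
case: E => E1 E2; rewrite /norm.
transitivity ((n ^+ i * e.1) ^+ 2 - (n ^+ i * e.2) ^+ 2 * F); last by rewrite -exprM mulnC exprM; ring.
by rewrite E1 E2; ring.
Qed.

(** The norm of w + 1 differs from that of w by the trace plus one, so the trace
    2p/n is a polynomial. *)
Lemma integral_trace n w p q : n != 0 -> reg U w ->
  (forall P, U P -> n.[x P] * w P = p.[x P] + q.[x P] * y P) ->
  (n %| p) && (n ^+ 2 %| q ^+ 2 * F).
Proof.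
move=> n0 rw h; have d1 := @integral_norm n w (p, q) n0 rw h.
have d2 : n ^+ 2 %| norm (p + n, q).
  apply: (@integral_norm n (fun P => w P + 1)) => //; first exact: (regD lX oU rw (reg_cst lX 1 oU)).
  by move=> P UP; rewrite mulrDr h // /value /= !hornerE /=; ring.
have np : n %| p.
  have : n ^+ 2 %| norm (p + n, q) - norm (p, q) - n ^+ 2 by apply: dvdp_sub => //; apply: dvdp_sub.
  have -> : norm (p + n, q) - norm (p, q) - n ^+ 2 = n * (2%:R *: p).
    by rewrite /norm /= -mul_polyC polyC_natr; ring.
  by rewrite expr2 dvdp_mul2l // dvdpZr.
rewrite np /=.
have -> : q ^+ 2 * F = p ^+ 2 - norm (p, q) by rewrite /norm /=; ring.
by rewrite dvdp_sub // dvdp_exp2r.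
Qed.

(** By [integral_trace], w - p/n = q y/n is a regular function.  A Bezout relation
    between n and q in lowest terms makes y/n regular, with a square of
    smaller degree than F unless n is constant. *)
Lemma minimal_span : (forall y' F', quadratic y' F' -> (size F <= size F')%N) ->
  forall w, reg U w -> exists p q, forall P, U P -> w P = p.[x P] + q.[x P] * y P.
Proof.
move=> Fmin w rw.
have [n [p [q [n0 h]]]] := irrational_dep iy ry rw.
have /andP[/dvdpP[p' pE] nq] := integral_trace n0 rw h.
pose z P := w P - p'.[x P].
have rz : reg U z by apply: regB.
have hz P : U P -> n.[x P] * z P = q.[x P] * y P.
  by move=> UP; rewrite mulrBr h // pE hornerM; ring.
set g := gcdp n q.
have g0 : g != 0 by rewrite gcdp_eq0 negb_and n0.
pose n' := n %/ g; pose q' := q %/ g.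
have nE : n = n' * g by rewrite divpK // dvdp_gcdl.
have qE : q = q' * g by rewrite divpK // dvdp_gcdr.
have n'0 : n' != 0 by apply: contraNneq n0 => e; rewrite nE e mul0r.
have cop : coprimep n' q' by apply: coprimep_div_gcd; rewrite n0.
have hz' P : U P -> n'.[x P] * z P = q'.[x P] * y P.
  move: P; apply: (chart_cancel g0); [exact: regM|exact: regM|move=> P UP].
  by have := hz P UP; rewrite {1}nE {1}qE !hornerM => e; rewrite mulrCA mulrA e; ring.
have [[s t] /= st] := Bezout_eq1_coprimepP _ _ cop.
pose y' P := t.[x P] * z P + s.[x P] * y P.
have ry' : reg U y' by apply: (regD lX) => //; apply: (regM lX).
have hy P : U P -> n'.[x P] * y' P = y P.
  move=> UP; rewrite /y' mulrDr mulrCA hz' //.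
  transitivity ((s * n' + t * q').[x P] * y P); first by rewrite !hornerE /=; ring.
  by rewrite st hornerC mul1r.
have : n' ^+ 2 %| F.
  move: nq; rewrite {1}nE {1}qE !exprMn [X in _ %| X]mulrAC dvdp_mul2r ?expf_neq0 // mulrC.
  by rewrite Gauss_dvdpl // coprimep_expl // coprimep_expr.
case/dvdpP => F' FE.
have Q' : quadratic y' F'.
  split => //.
    move=> m r e; have /eqP : m = 0; last by move/eqP.
    by apply: (iy (p := n' * r)) => P UP; rewrite -hy // hornerM -e //; ring.
  apply: (@chart_cancel (n' ^+ 2)); rewrite ?expf_neq0 //; first exact: reg_exp.
  move=> P UP; rewrite -hornerM [_ * F']mulrC -FE -ey // -hy // !hornerE /=; ring.
have F'0 : F' != 0.
  apply/eqP => F'0; suff /eqP : 1 = 0 :> {poly k} by rewrite oner_eq0.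
  apply: (iy (p := 0)) => P UP; rewrite horner0 hornerC mul1r; apply/eqP.
  by rewrite -sqrf_eq0 ey // FE F'0 mul0r horner0.
have s1 : size n' = 1%N.
  have := Fmin _ _ Q'; rewrite FE size_mul ?expf_neq0 //.
  have := size_exp n' 2; have : (0 < size n')%N by rewrite size_poly_gt0.
  have : (0 < size F')%N by rewrite size_poly_gt0.
  by move: (size (n' ^+ 2)) (size n') (size F') => [|i] j l; lia.
have /size_poly1P[c c0 cE] : size n' == 1%N by rewrite s1.
exists p', (c^-1 *: q') => P UP.
apply: (mulfI c0); have := hz' P UP; rewrite cE hornerC => e.
by rewrite -[w P](subrK p'.[x P]) mulrDr -/(z P) e !hornerE /=; field.
Qed.
End Quadratic.

Section Squarefree.
Variables (y : X -> k) (F : {poly k}).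
Hypothesis Qy : quadratic y F.
Let ry : reg U y. Proof. by case: Qy. Qed.
Let iy : irrational y. Proof. by case: Qy. Qed.
Let ey P : U P -> y P ^+ 2 = F.[x P]. Proof. by case: Qy => _ _; apply. Qed.
Hypothesis span : forall w, reg U w ->
  exists p q, forall P, U P -> w P = p.[x P] + q.[x P] * y P.
Variables (a : k) (Fa : F.[a] = 0) (F'a : F^`().[a] = 0).

(** Otherwise 1/(x - a) is regular, hence p + q y, and (x - a) p = 1. *)
Lemma fiber_nonempty : exists P, U P /\ x P = a.
Proof.
apply: NNPP => h.
have nz P : U P -> x P - a != 0.
  by move=> UP; rewrite subr_eq0; apply/eqP => e; apply: h; exists P.
have [p [q pq]] := span (regV lX oU (regB lX oU rx (reg_cst lX a oU)) nz).
have [|/eqP] := @irrational_free y (('X - a%:P) * p - 1) (('X - a%:P) * q) iy.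
  move=> P UP; rewrite !hornerE /=.
  transitivity ((x P - a) * (p.[x P] + q.[x P] * y P) - 1); first by ring.
  by rewrite -pq // divff ?subrr // nz.
rewrite subr_eq0 => /eqP/(congr1 (horner^~ a)).
by rewrite !hornerE /= subrr mul0r => /esym/eqP; rewrite oner_eq0.
Qed.

(** Over a double root [a] of [F], the class of a function vanishing at
    (a, 0) modulo the square of the maximal ideal is read off from its numerator
    [p + q y]: it is given by [p'(a)] and [q(a)]. *)
Definition flat (h : X -> k) := exists n p q, [/\ n.[a] != 0, p.[a] = 0, p^`().[a] = 0,
  q.[a] = 0 & generic (fun Q => n.[x Q] * h Q = p.[x Q] + q.[x Q] * y Q)].

Lemma flat0 : flat (fun _ => 0).
Proof.
exists 1, 0, 0; rewrite deriv0 !horner0 hornerC oner_neq0; split => //.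
by apply: (genericT lX iX) => Q; rewrite hornerC !horner0; ring.
Qed.

Lemma flat_lin c h h' : flat h -> flat h' -> flat (fun Q => c * h Q + h' Q).
Proof.
move=> [n [p [q [na pa p'a qa e]]]] [n' [p' [q' [n'a p'a' p''a q'a e']]]].
exists (n * n'), (c *: (n' * p) + n * p'), (c *: (n' * q) + n * q').
split; rewrite ?derivD ?derivZ ?derivM ?hornerE /= ?mulf_neq0 ?pa ?p'a ?qa ?p'a' ?p''a ?q'a ?mulr0 ?addr0 ?mulr0 //.
apply: (generic2 lX iX) e e' => Q; rewrite !hornerE /= => e e'.
transitivity (c * n'.[x Q] * (n.[x Q] * h Q) + n.[x Q] * (n'.[x Q] * h' Q)); first ring.
by rewrite e e'; ring.
Qed.

Lemma flat_generic h h' : generic (fun Q => h' Q = h Q) -> flat h -> flat h'.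
Proof.
move=> hh [n [p [q [na pa p'a qa e]]]]; exists n, p, q; split => //.
by apply: (generic2 lX iX) hh e => Q ->.
Qed.

Lemma flat_linear alpha beta :
  flat (fun Q => alpha * (x Q - a) + beta * y Q) -> alpha = 0 /\ beta = 0.
Proof.
move=> [n [p [q [na pa p'a qa e]]]].
have E P : U P -> n.[x P] * (alpha * (x P - a) + beta * y P) = p.[x P] + q.[x P] * y P.
  move: P; apply: (reg_generic lX iX oU) => //.
    apply: (regM lX) => //; apply: (regD lX) => //; apply: (regM lX) => //.
    - exact: reg_cst.
    - by apply: (regB lX) => //; exact: reg_cst.
    - exact: reg_cst.
  by apply: (regD lX) => //; apply: (regM lX).
have [|E1 E2] := @irrational_free y (alpha *: (n * ('X - a%:P)) - p) (beta *: n - q) iy.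
  move=> P UP; rewrite !hornerE /=; have /eqP := E P UP; rewrite -subr_eq0 => /eqP <-; ring.
split.
  move: (congr1 (fun p => p^`().[a]) E1).
  rewrite derivB derivZ derivM derivB derivX derivC !hornerE /= p'a.
  rewrite subrr deriv0 horner0 ?(mulr0, mulr1, subr0, add0r, addr0, oppr0) => /eqP.
  by rewrite mulf_eq0 (negPf na) orbF => /eqP.
move: (congr1 (horner^~ a) E2); rewrite !hornerE /= qa oppr0 addr0 => /eqP.
by rewrite mulf_eq0 (negPf na) orbF => /eqP.
Qed.

Variable P : X.
Hypotheses (UP : U P) (xP : x P = a).
Let yP : y P = 0.
Proof. by apply/eqP; rewrite -sqrf_eq0 ey // xP Fa. Qed.

(** The denominator p_2 + q_2 y is made a polynomial in x by its conjugate. *)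
Lemma max_ideal_frac g : max_ideal P g -> exists n p q, [/\ n.[a] != 0, p.[a] = 0 &
  generic (fun Q => n.[x Q] * g Q = p.[x Q] + q.[x Q] * y Q)].
Proof.
move=> [[W [oW WP rg]] gP].
have [A [B [rA rB BP AB]]] := ch_loc cU oW WP UP rg.
have [p1 [q1 hA]] := span rA; have [p2 [q2 hB]] := span rB.
have AP : A P = 0.
  by have [_] := AB P UP BP; rewrite gP => /esym/eqP; rewrite mulf_eq0 invr_eq0 (negPf BP) orbF => /eqP.
move: BP AP; rewrite hA // hB // xP yP !mulr0 !addr0 => BP AP.
exists (p2 ^+ 2 - q2 ^+ 2 * F), (p1 * p2 - q1 * q2 * F), (q1 * p2 - p1 * q2).
split; rewrite ?hornerE /= ?Fa ?AP ?mulr0 ?mul0r ?subr0 ?mulf_neq0 //.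
exists (fun Q => U Q /\ B Q != 0); split; first exact: opn_neq0.
  by exists P; split => //; rewrite hB // xP yP mulr0 addr0.
move=> Q [UQ BQ]; have [_ ->] := AB Q UQ BQ.
move: BQ; rewrite hA // hB // !hornerE /= -ey // => BQ.
by field.
Qed.

(** Here F(a) = F'(a) = 0 is used. *)
Lemma flatM g h : max_ideal P g -> max_ideal P h -> flat (fun Q => g Q * h Q).
Proof.
move=> /max_ideal_frac[n1 [p1 [q1 [n1a p1a e1]]]] /max_ideal_frac[n2 [p2 [q2 [n2a p2a e2]]]].
exists (n1 * n2), (p1 * p2 + q1 * q2 * F), (p1 * q2 + q1 * p2).
split; rewrite ?derivD ?derivM ?hornerE /= ?p1a ?p2a ?Fa ?F'a ?mulr0 ?mul0r ?addr0 ?mulf_neq0 //.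
have gU := generic_opn oU (ex_intro _ P UP).
apply: (generic3 lX iX) gU e1 e2 => Q UQ e1 e2; rewrite !hornerE /= -ey //.
transitivity ((n1.[x Q] * g Q) * (n2.[x Q] * h Q)); first by ring.
by rewrite e1 e2; ring.
Qed.

Lemma flat_max_ideal_sq h : max_ideal_sq P h -> flat h.
Proof.
move=> [r [g [g' [mg [W [oW WP e]]]]]].
apply: (@flat_generic (fun Q => \sum_(i <- enum 'I_r) g i Q * g' i Q)).
  by exists W; split => //; [exists P|move=> Q WQ; rewrite e // big_enum].
elim: (enum 'I_r) => [|i s IH].
  by apply: flat_generic flat0; apply: (genericT lX iX) => Q; rewrite big_nil.
have [m1 m2] := mg i; apply: flat_generic (flat_lin 1 (flatM m1 m2) IH).
by apply: (genericT lX iX) => Q; rewrite big_cons mul1r.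
Qed.

(** Modulo the square of the maximal ideal x - a and y are linearly independent, but
    the cotangent space has dimension 1. *)
Lemma double_root_absurd : False.
Proof.
have [t [_ gen _]] := ch_smooth cU UP.
have m1 : max_ideal P (fun Q => x Q - a).
  split; last by rewrite xP subrr.
  by exists U; split => //; apply: (regB lX) => //; exact: reg_cst.
have m2 : max_ideal P y by split; [exists U|].
have [c1 /flat_max_ideal_sq f1] := gen _ m1; have [c2 /flat_max_ideal_sq f2] := gen _ m2.
have f3 := flat_lin (c2 ord0) f1 (flat_lin (- c1 ord0) f2 flat0).
have [|c20 c10] := @flat_linear (c2 ord0) (- c1 ord0).
  by apply: flat_generic f3; apply: (genericT lX iX) => Q; rewrite !big_ord1; ring.
have [|/eqP] := @flat_linear 1 0; last by rewrite oner_eq0.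
apply: flat_generic f1; apply: (genericT lX iX) => Q; rewrite big_ord1.
have -> : c1 ord0 = 0 by apply/eqP; rewrite -oppr_eq0 c10.
by ring.
Qed.
End Squarefree.

Theorem chart_dcover : exists y F, dcover U x y F.
Proof.
have [_ [[y [F [Qy <-]]] Fmin]] : exists n : nat, (exists y F, quadratic y F /\ size F = n) /\
    forall m : nat, (exists y F, quadratic y F /\ size F = m) -> (n <= m)%N.
  by apply: ex_min; have [y [F Qy]] := quadratic_exists; exists (size F), y, F.
have hmin y' F' : quadratic y' F' -> (size F <= size F')%N.
  by move=> Q'; apply: Fmin; exists y', F'.
have span := minimal_span Qy hmin.
have [ry iy ey] := Qy.
exists y, F; split => //; [exact: (ch_loc cU)|exact: (ch_dom cU)| |].
  by move=> p q; apply: irrational_free.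
move=> a /eqP Fa; apply/negP => /eqP F'a.
have [P [UP xP]] := fiber_nonempty Qy span a.
exact: (double_root_absurd Qy span Fa F'a UP xP).
Qed.
End OneChart.
End Chart.

(** * Principal parts and acyclicity of a chart *)

Lemma ex_choice (S T : Type) (R : S -> T -> Prop) :
  (forall a, exists b, R a b) -> exists h, forall a, R a (h a).
Proof.
move=> h; exists (fun a => proj1_sig (constructive_indefinite_description _ (h a))) => a.
exact: proj2_sig (constructive_indefinite_description _ (h a)).
Qed.

Section Cover.
Variables (k : closedFieldType) (X : fun_space k).
Hypothesis lX : lawful X.
Hypothesis iX : irreducible X.
Hypothesis two_neq0 : 2%:R != 0 :> k.
Implicit Types (V W : X -> Prop) (g w t r : X -> k) (P Q : X) (p q n : {poly k}).

Section OneChart.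
Variables (U : X -> Prop) (x y : X -> k) (f : {poly k}).
Hypothesis dc : dcover U x y f.
Let oU := dc_opn dc.
Let rx := dc_x dc.
Let ry := dc_y dc.

Lemma dc_reg p q : reg U (fun P => p.[x P] + q.[x P] * y P).
Proof. by apply: (regD lX) => //; [|apply: (regM lX) => //]; exact: reg_poly. Qed.

Lemma dc_nonempty : nonempty U.
Proof. by have [P [UP _]] := dc_dom dc (oner_neq0 _); exists P. Qed.

Lemma dc_generic : generic U.
Proof. exact: generic_opn oU dc_nonempty. Qed.

Lemma dc_generic_neq0 p : p != 0 -> generic (fun P => U P /\ p.[x P] != 0).
Proof.
move=> /(dc_dom dc)[P [UP pP]]; exists (fun P => U P /\ p.[x P] != 0).
by split => //; [apply: opn_neq0 => //; exact: reg_poly|exists P].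
Qed.

Lemma dc_generic_free p q : generic (fun P => p.[x P] + q.[x P] * y P = 0) -> p = 0 /\ q = 0.
Proof.
move=> h; apply: (dc_free dc); apply: (reg_generic lX iX oU) h; first exact: dc_reg.
exact: reg_cst.
Qed.

Lemma dc_generic_inj p q p' q' :
  generic (fun P => p.[x P] + q.[x P] * y P = p'.[x P] + q'.[x P] * y P) -> p = p' /\ q = q'.
Proof.
move=> h; case: (@dc_generic_free (p - p') (q - q')).
  apply: generic1 h => P; rewrite !hornerE /= => /eqP; rewrite -subr_eq0 => /eqP <-; ring.
by move=> /eqP; rewrite subr_eq0 => /eqP -> /eqP; rewrite subr_eq0 => /eqP ->.
Qed.

(** Multiplying by the conjugate of the denominator. *)
Lemma dc_frac P r : U P -> ext P r -> exists n p q, n != 0 /\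
  generic (fun Q => n.[x Q] * r Q = p.[x Q] + q.[x Q] * y Q).
Proof.
move=> UP [W [g [oW WP rg e]]].
have [A [B [rA rB BP AB]]] := dc_loc dc oW WP UP rg.
have [p1 [q1 hA]] := dc_span dc rA; have [p2 [q2 hB]] := dc_span dc rB.
have gB : generic (fun Q => U Q /\ B Q != 0).
  by apply: generic_opn; [exact: opn_neq0|exists P].
exists (p2 ^+ 2 - q2 ^+ 2 * f), (p1 * p2 - q1 * q2 * f), (q1 * p2 - p1 * q2); split.
  apply/eqP => N0; case: (@dc_generic_free p2 (- q2)).
    apply: generic1 gB => Q [UQ BQ]; apply: (mulIf BQ); rewrite mul0r hB //.
    transitivity ((p2 ^+ 2 - q2 ^+ 2 * f).[x Q]); last by rewrite N0 horner0.
    rewrite !hornerE /= -(dc_eq dc) //; ring.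
  move=> p20 /eqP; rewrite oppr_eq0 => /eqP q20.
  by move: BP; rewrite hB // p20 q20 !horner0 mul0r addr0 eqxx.
apply: (generic2 lX iX) gB e => Q [UQ BQ] ->.
have [_ ->] := AB Q UQ BQ.
move: BQ; rewrite hA // hB // !hornerE /= -(dc_eq dc) // => BQ.
by field.
Qed.

(** Points of [U] with the same coordinates are not separated by regular functions,
    hence by no open set. *)
Lemma dc_opn_indist W P Q : opn W -> W P -> U P -> U Q -> x Q = x P -> y Q = y P -> W Q.
Proof.
move=> oW WP UP UQ xQ yQ.
have [A [B [rA rB BP AB]]] := dc_loc dc oW WP UP (reg_cst lX 1 oW).
have [p2 [q2 hB]] := dc_span dc rB.
by have [] := AB Q UQ; rewrite // hB // xQ yQ -hB.
Qed.

Lemma dc_ext_indist r P Q : ext P r -> U P -> U Q -> x Q = x P -> y Q = y P -> ext Q r.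
Proof.
move=> [W [g [oW WP rg e]]] UP UQ xQ yQ; exists W, g; split => //.
exact: dc_opn_indist WP UP UQ xQ yQ.
Qed.

Lemma ext_dc P p q : U P -> ext P (fun Q => p.[x Q] + q.[x Q] * y Q).
Proof. by move=> UP; apply: (ext_reg lX iX oU) => //; exact: dc_reg. Qed.

Lemma ext_ratio P p q n : U P -> n.[x P] != 0 ->
  ext P (fun Q => (p.[x Q] + q.[x Q] * y Q) / n.[x Q]).
Proof.
move=> UP nP; apply: extM => //; first exact: ext_dc.
by apply: (ext_inv lX iX oU UP) => //; exact: reg_poly.
Qed.

(** [y - b] vanishes at (a, b) to the order of [x - a], unless b = 0. *)
Lemma ext_slope P : U P -> y P != 0 -> ext P (fun Q => (y Q - y P) / (x Q - x P)).
Proof.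
move=> UP yP.
have [g gE] : exists g : {poly k}, f - (f.[x P])%:P = g * ('X - (x P)%:P).
  by apply/factor_theorem; rewrite rootE !hornerE subrr.
have rs : reg U (fun Q => y Q + y P) by apply: (regD lX) => //; exact: reg_cst.
have e1 : ext P (fun Q => g.[x Q] * (y Q + y P)^-1).
  apply: extM => //; first by apply: (ext_reg lX iX oU) => //; exact: reg_poly.
  by apply: (ext_inv lX iX oU UP rs); rewrite -mulr2n -mulr_natl mulf_neq0.
apply: ext_generic e1 => //.
have nX : 'X - (x P)%:P != 0 by rewrite polyXsubC_eq0.
have gs : generic (fun Q => U Q /\ y Q + y P != 0).
  apply: generic_opn; first exact: opn_neq0.
  by exists P; split => //; rewrite -mulr2n -mulr_natl mulf_neq0.
apply: (generic2 lX iX) (dc_generic_neq0 nX) gs => Q [UQ]; rewrite !hornerE /= => xQ [_ yQ].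
have := congr1 (horner^~ (x Q)) gE; rewrite !hornerE /= -(dc_eq dc) // -(dc_eq dc) // => E.
apply: (mulIf xQ); apply: (mulIf yQ); rewrite divfK // mulrAC -mulrA mulrA divfK //.
by rewrite -E; ring.
Qed.

(** A principal part at one point is realized by a function whose only poles are
    there: the pole that it creates at the conjugate point is removed by a
    partition of unity in [k[y]]. *)
Lemma principal_part P r : U P -> (exists2 R, U R & ext R r) ->
  exists r', ext P (fun z => r z - r' z) /\
    forall Q, U Q -> ~ (x Q = x P /\ y Q = y P) -> ext Q r'.
Proof.
move=> UP [R UR eR]; have [n [p [q [n0 rE]]]] := dc_frac UR eR.
set a := x P; set b := y P.
have [e [n1 /implyP/(_ n0) n1a nE]] := multiplicity_XsubC n a.
(* r splits as rest + pole, where pole has the denominator (x - a)^e only *)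
have cop : coprimep (('X - a%:P) ^+ e) n1.
  by apply: coprimep_expl; rewrite coprimep_sym coprimep_XsubC.
have [[u v] /= uv] := Bezout_eq1_coprimepP _ _ cop.
pose pole Q := ((v * p).[x Q] + (v * q).[x Q] * y Q) / (('X - a%:P) ^+ e).[x Q].
pose rest Q := ((u * p).[x Q] + (u * q).[x Q] * y Q) / n1.[x Q].
have er : generic (fun z => r z = rest z + pole z).
  apply: (generic2 lX iX) (dc_generic_neq0 n0) rE => Q [UQ nQ] E.
  have : n.[x Q] != 0 := nQ; rewrite nE hornerM mulf_eq0 negb_or => /andP[n1Q eQ].
  apply: (mulfI nQ); rewrite E nE /rest /pole hornerM.
  have := congr1 (horner^~ (x Q)) uv; rewrite !hornerD !hornerM hornerC => uvQ.
  by rewrite -[LHS]mul1r -uvQ; field; rewrite eQ n1Q.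
have erest : ext P rest by apply: ext_ratio.
have epole Q : U Q -> x Q <> a -> ext Q pole.
  move=> UQ xQ; apply: ext_ratio => //; rewrite horner_exp expf_neq0 // !hornerE subr_eq0.
  exact/eqP.
have [b0|b0] := eqVneq b 0.
  exists pole; split.
    by apply: ext_generic erest => //; apply: generic1 er => z ->; rewrite addrK.
  move=> Q UQ nQ; apply: epole => // xQ; apply: nQ; split => //; rewrite -/b b0.
  by apply/eqP; rewrite -sqrf_eq0 (dc_eq dc) // xQ -(dc_eq dc) // -/b b0 expr0n.
have cop2 : coprimep ('X ^+ e) ((1 - 'X : {poly k}) ^+ e).
  apply: coprimep_expl; apply: coprimep_expr; apply/Bezout_eq1_coprimepP.
  by exists (1, 1); rewrite /= !mul1r addrC subrK.
(* 1 - eps vanishes at P, and eps at the conjugate point, to the order of x - a *)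
have [[s t] /= st] := Bezout_eq1_coprimepP _ _ cop2.
have b2 : 2%:R * b != 0 by rewrite mulf_neq0.
pose eps Q := (y Q + b) / (2%:R * b).
have epsE Q : s.[eps Q] * eps Q ^+ e + t.[eps Q] * (1 - eps Q) ^+ e = 1.
  have := congr1 (horner^~ (eps Q)) st; rewrite hornerD !hornerM !horner_exp.
  by rewrite hornerD hornerN hornerX !hornerC.
have eeps Q : U Q -> ext Q eps.
  move=> UQ; apply: (ext_reg lX iX oU) => //; apply: (regM lX) => //; last exact: reg_cst.
  by apply: (regD lX) => //; exact: reg_cst.
exists (fun Q => s.[eps Q] * eps Q ^+ e * pole Q).
have reg1 Q (d : k) c : U Q -> x Q = a -> y Q = d -> d != 0 ->
    ext Q (fun z => ((y z - d) / c) ^+ e * pole z).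
  move=> UQ xQ yQ d0; subst d; have := ext_slope UQ d0; rewrite xQ => sl.
  have := extM lX iX (extM lX iX (extX lX iX e sl) (ext_cst lX iX Q (c^-1 ^+ e))) (ext_dc (v * p) (v * q) UQ).
  apply: ext_generic => //; apply: (genericT lX iX) => z.
  by rewrite /pole horner_exp !hornerE /= !exprMn -exprVn; ring.
split.
  have e1 : ext P (fun z => t.[eps z] * (((y z - b) / (- (2%:R * b))) ^+ e * pole z)).
    by apply: extM => //; [apply: ext_poly => //; exact: eeps|exact: reg1].
  apply: ext_generic (extD lX iX erest e1) => //.
  apply: generic1 er => z ->.
  have -> : (y z - b) / (- (2%:R * b)) = 1 - eps z.
    by rewrite /eps; field; rewrite b0 two_neq0 oppr_eq0 b2.
  rewrite -addrA; congr (_ + _).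
  transitivity ((s.[eps z] * eps z ^+ e + t.[eps z] * (1 - eps z) ^+ e) * pole z
     - s.[eps z] * eps z ^+ e * pole z); last by ring.
  by rewrite epsE mul1r.
move=> Q UQ nQ; have [xQ|xQ] := eqVneq (x Q) a; last first.
  apply: extM => //; last by apply: epole => //; exact/eqP.
  by apply: extM => //; [apply: ext_poly => //; exact: eeps|apply: extX => //; exact: eeps].
have yQ : y Q = - b.
  have : (y Q - b) * (y Q + b) = 0.
    by rewrite -subr_sqr !(dc_eq dc) // xQ subrr.
  move/eqP; rewrite mulf_eq0 subr_eq0 addr_eq0 => /orP[/eqP yQ|/eqP//].
  by case: nQ.
have e1 : ext Q (fun z => s.[eps z] * (((y z - - b) / (2%:R * b)) ^+ e * pole z)).
  apply: extM => //; [apply: ext_poly => //; exact: eeps|apply: reg1 => //].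
  by rewrite oppr_eq0.
by apply: ext_generic e1 => //; apply: (genericT lX iX) => z; rewrite opprK -/(eps z) [RHS]mulrA.
Qed.

Section Cocycle.
Variables (I : Type) (V : I -> X -> Prop) (s : I -> I -> X -> k) (i0 : I).
Hypotheses (cV : open_cover V) (cs : cocycle V s) (ne0 : nonempty (V i0)).

Lemma cocycle_generic i j : nonempty (V i) -> nonempty (V j) ->
  generic (fun P => s i0 j P = s i0 i P + s i j P).
Proof.
case: cV => oV _; case: cs => _ scoc nei nej.
apply: (generic3 lX iX) (generic_opn (oV i0) ne0) (generic_opn (oV i) nei) (generic_opn (oV j) nej).
by move=> P; exact: scoc.
Qed.

Lemma cocycle_ext i j P : V i P -> V j P -> ext P (s i j).
Proof.
case: cV => oV _; case: cs => rs _ Vi Vj.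
by apply: (ext_reg lX iX (opnI lX (oV i) (oV j))).
Qed.

(** By induction on the list of points (a, b) of the curve, adding one principal part
    at a time.  Over one (a, b) it does not matter which V i is used: the s i j are
    regular there. *)
Lemma principal_parts (L : seq (k * k)) : exists r,
  (forall P i, U P -> V i P -> (x P, y P) \in L -> ext P (fun z => r z + s i0 i z)) /\
  (forall P, U P -> (x P, y P) \notin L -> ext P r).
Proof.
elim: L => [|c L [r [rin rout]]].
  by exists (fun _ => 0); split => // P _ _; exact: ext_cst.
have [cL|cL] := boolP (c \in L).
  exists r; split=> [P i UP ViP|P UP]; rewrite inE.
    by case/orP => [/eqP e|]; apply: rin => //; rewrite e.
  by rewrite negb_or => /andP[_]; exact: rout.
have [[P0 [UP0 cE]]|nP0] := classic (exists P, U P /\ (x P, y P) = c); last first.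
  exists r; split=> [P i UP ViP|P UP]; rewrite inE.
    by case/orP => [/eqP e|]; [case: nP0; exists P|apply: rin].
  by rewrite negb_or => /andP[_]; exact: rout.
have [i Vi] : exists i, V i P0 by case: cV => _ /(_ P0).
have oV := cV.1.
have [R [UR [V0R ViR]]] : exists R, U R /\ (V i0 R /\ V i R).
  apply: generic_ex; apply: (generic3 lX iX) dc_generic (generic_opn (oV i0) ne0) (generic_opn (oV i) _) => //.
  by exists P0.
have [r' [e1 e2]] := principal_part UP0 (ex_intro2 _ _ R UR (extN lX iX (cocycle_ext V0R ViR))).
exists (fun z => r z + r' z); split.
  move=> P j UP VjP; rewrite inE => /orP[/eqP e|inL]; last first.
    have er' : ext P r'.
      by apply: e2 => // [[xP yP]]; move: cL; rewrite -cE -xP -yP inL.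
    apply: ext_generic (extD lX iX (rin P j UP VjP inL) er') => //.
    by apply: (genericT lX iX) => z; ring.
  have [xP yP] : x P = x P0 /\ y P = y P0 by move: e; rewrite -cE => -[].
  have ViP : V i P by exact: dc_opn_indist (oV i) Vi UP0 UP xP yP.
  have er : ext P r by apply: rout; rewrite // e.
  have er' := dc_ext_indist e1 UP0 UP xP yP.
  apply: ext_generic (extD lX iX (extB lX iX er er') (cocycle_ext ViP VjP)) => //.
  apply: generic1 (cocycle_generic (ex_intro _ P ViP) (ex_intro _ P VjP)) => z ->; ring.
move=> P UP; rewrite inE negb_or => /andP[nc nL]; apply: extD => //; first exact: rout.
apply: e2 => // [[xP yP]]; case/eqP: nc; by rewrite xP yP.
Qed.

Lemma all_roots p : p != 0 -> exists rs : seq k, forall a, root p a -> a \in rs.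
Proof.
move=> p0; have [rs E] := closed_field_poly_normal p; exists rs => a.
by rewrite E rootZ ?lead_coef_eq0 // root_prod_XsubC.
Qed.

(** The chart is acyclic: only finitely many points of [U] lie outside [V i0], and
    a function with prescribed principal parts there splits the cocycle. *)
Lemma chart_acyclic : exists r,
  forall P i, U P -> V i P -> ext P (fun z => r z + s i0 i z).
Proof.
have oV := cV.1.
have [R [UR V0R]] := opn_meet iX oU dc_nonempty (oV i0) ne0.
have [A [B [rA rB BR AB]]] := dc_loc dc (oV i0) V0R UR (reg_cst lX 1 (oV i0)).
have [p [q hB]] := dc_span dc rB.
(* V i0 contains the set where the norm N of B does not vanish *)
pose N := p ^+ 2 - q ^+ 2 * f.
have NE P : U P -> N.[x P] = B P * (p.[x P] - q.[x P] * y P).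
  by move=> UP; rewrite hB // /N !hornerE /= -(dc_eq dc) //; ring.
have N0 : N != 0.
  apply/eqP => N0; case: (@dc_generic_free p (- q)).
    have gB : generic (fun Q => U Q /\ B Q != 0).
      by apply: generic_opn; [exact: opn_neq0|exists R].
    apply: generic1 gB => Q [UQ BQ]; apply: (mulfI BQ); rewrite mulr0.
    by rewrite hornerN mulNr -NE // N0 horner0.
  move=> p20 /eqP; rewrite oppr_eq0 => /eqP q20.
  by move: BR; rewrite hB // p20 q20 !horner0 mul0r addr0 eqxx.
have [rs rsP] := all_roots N0.
have/ex_choice[ys ysP] (a : k) : exists ys : seq k, forall b, b ^+ 2 = f.[a] -> b \in ys.
  have [|ys h] := @all_roots ('X^2 - (f.[a])%:P); first by rewrite -size_poly_eq0 size_XnsubC.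
  by exists ys => b e; apply: h; rewrite rootE !hornerE e subrr.
have [r [rin rout]] := principal_parts [seq (a, b) | a <- rs, b <- ys a].
exists r => P i UP ViP; have [inL|nL] := boolP ((x P, y P) \in [seq (a, b) | a <- rs, b <- ys a]).
  exact: rin.
have NP : N.[x P] != 0.
  apply: contra nL => NP; apply/allpairsPdep; exists (x P), (y P); split => //; first exact: rsP.
  by apply: ysP; rewrite (dc_eq dc).
have V0P : V i0 P by apply: (AB P UP _).1; apply: contraNneq NP => B0; rewrite NE // B0 mul0r.
by apply: extD => //; [exact: rout|exact: cocycle_ext].
Qed.
End Cocycle.

(** A root a != 0 of the denominator n = n' (x - a) cancels: n' t is regular over a by
    assumption, and elsewhere as (p + q y)/(x - a). *)
Lemma laurent t : (forall P, U P -> x P != 0 -> ext P t) ->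
  exists (E : nat) p q, generic (fun P => x P ^+ E * t P = p.[x P] + q.[x P] * y P).
Proof.
move=> ht; have nX : 'X != 0 :> {poly k} by rewrite polyX_eq0.
have [P0 [UP0]] := dc_dom dc nX; rewrite hornerX => xP0.
have [n [p [q [n0 e]]]] := dc_frac UP0 (ht P0 UP0 xP0).
elim: {n}(size n) {-2}n (leqnn (size n)) p q n0 e => [|m IH] n sn p q n0 e.
  by move: sn; rewrite leqn0 size_poly_eq0 (negPf n0).
have [E [n1 /implyP/(_ n0) n1a nE]] := multiplicity_XsubC n 0.
have [/size_poly1P[c c0 cE]|n1s] := boolP (size n1 == 1%N).
  exists E, (c^-1 *: p), (c^-1 *: q); apply: generic1 e => Q.
  rewrite nE cE subr0 !hornerE /= => e.
  by apply: (mulfI c0); rewrite mulrA e; field.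
have /closed_rootP[a n1_a] := n1s.
have a0 : a != 0 by apply: contraNneq n1a => <-.
have na : root n a by rewrite nE rootM n1_a.
have [n' n'E] := factor_theorem _ _ na.
have n'0 : n' != 0 by apply: contraNneq n0 => e0; rewrite n'E e0 mul0r.
have nXa : 'X - a%:P != 0 by rewrite polyXsubC_eq0.
have ew P : U P -> ext P (fun Q => n'.[x Q] * t Q).
  move=> UP; have [xP|xP] := eqVneq (x P) a.
    apply: extM => //; last by apply: ht => //; rewrite xP.
    by apply: (ext_reg lX iX oU) => //; exact: reg_poly.
  have nX' : ('X - a%:P).[x P] != 0 by rewrite !hornerE subr_eq0.
  apply: ext_generic (ext_ratio p q UP nX') => //.
  apply: (generic2 lX iX) (dc_generic_neq0 nXa) e => Q [UQ nQ]; rewrite n'E hornerM => E'.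
  by apply: (mulIf nQ); rewrite divfK // -E'; ring.
have [w [rw ww]] := ext_glue lX iX oU dc_nonempty ew.
have [p' [q' wE]] := dc_span dc rw.
apply: (IH n' _ p' q' n'0).
  by move: sn; rewrite n'E size_mul ?polyXsubC_eq0 // size_XsubC addn2.
by apply: (generic2 lX iX) dc_generic ww => Q UQ ->; exact: wE.
Qed.
End OneChart.
End Cover.

(** * Two charts with inverse coordinates *)

Section TwoCharts.
Variables (k : closedFieldType) (X : fun_space k).
Hypothesis lX : lawful X.
Hypothesis iX : irreducible X.
Hypothesis two_neq0 : 2%:R != 0 :> k.
Implicit Types (V W : X -> Prop) (g w t r : X -> k) (P Q : X) (p q n : {poly k}).

(** Charts on two opens, with inverse coordinates [x] and [v], that overlap where
    [x != 0]. *)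
Definition inverse_charts (U U' : X -> Prop) (x v : X -> k) :=
  [/\ forall P, U P -> x P != 0 -> U' P,
      forall P, U P -> U' P -> x P * v P = 1,
      opn U, opn U' & nonempty U /\ nonempty U'].

Lemma inverse_charts_generic U U' x v : inverse_charts U U' x v ->
  generic (fun P => [/\ U P, U' P, x P != 0, v P = (x P)^-1 & x P = (v P)^-1]).
Proof.
move=> [_ xv oU oU' [nU nU']].
apply: (generic2 lX iX) (generic_opn oU nU) (generic_opn oU' nU') => P UP UP'.
have e := xv P UP UP'.
have x0 : x P != 0 by apply: contra_eq_neq e => ->; rewrite mul0r eq_sym oner_neq0.
have vE : v P = (x P)^-1 by apply: (mulfI x0); rewrite e divff.
by split => //; rewrite vE invrK.
Qed.

(** In x^E y' = p + q y the square lies in k(x), so that 2 p q = 0; and q = 0 would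
    put y' in k(v). *)
Lemma odd_coordinate_multiple U U' x v y y' f f' : dcover U x y f -> dcover U' v y' f' ->
  inverse_charts U U' x v -> exists E q, generic (fun P => x P ^+ E * y' P = q.[x P] * y P).
Proof.
move=> dc dc' gl; have gg := inverse_charts_generic gl; have [U'x _ _ oU' _] := gl.
have [E [p [q e]]] : exists (E : nat) p q, generic (fun P => x P ^+ E * y' P = p.[x P] + q.[x P] * y P).
  apply: (laurent lX iX dc) => P UP xP.
  by apply: (ext_reg lX iX oU' (U'x P UP xP)); exact: dc_y dc'.
exists E, q; suff p0 : p = 0 by apply: generic1 e => P; rewrite p0 horner0 add0r.
pose d := size f'.
have /eqP : 2%:R *: ('X^d * (p * q)) = 0.
  apply: (dc_generic_inj lX iX dc (p := ('X^d * (p ^+ 2 + q ^+ 2 * f))) (p' := 'X^(E * 2) * recip d f') (q' := 0) _).2.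
  apply: (generic2 lX iX) gg e => P [UP UP' x0 vE xE] e.
  have F' := dc_eq dc' UP'; rewrite vE in F'.
  rewrite !hornerE /= horner_recip ?leqnSn // -F' -(dc_eq dc) //.
  transitivity (x P ^+ d * (x P ^+ E * y' P) ^+ 2); first by rewrite e; ring.
  by rewrite exprM; ring.
rewrite scaler_eq0 (negPf two_neq0) /= mulf_eq0 expf_eq0 polyX_eq0 andbF /= mulf_eq0.
case/orP => /eqP // q0.
pose D := size p.
have [/eqP] : 'X^D = 0 :> {poly k} /\ (- ('X^E * recip D p) = 0) ; last by rewrite expf_eq0 polyX_eq0 andbF.
apply/and_comm; apply: (dc_generic_free lX iX dc').
apply: (generic2 lX iX) gg e => P [UP UP' x0 vE xE] e.
have v0 : v P != 0 by rewrite vE invr_eq0.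
rewrite !hornerE /= horner_recip ?leqnSn // -xE.
move: e; rewrite q0 horner0 mul0r addr0 => <-.
have vx : v P ^+ E * x P ^+ E = 1 by rewrite -exprMn vE mulVf // expr1n.
transitivity (v P ^+ D * y' P * (1 - v P ^+ E * x P ^+ E)); first by ring.
by rewrite vx subrr mulr0.
Qed.

Lemma dvd_Xn q N : q %| 'X^N -> exists c l, c != 0 /\ q = c *: 'X^l.
Proof.
rewrite -['X]subr0; case/dvdp_exp_XsubCP => l _ /eqpf_eq[c c0 ->].
by exists c, l; rewrite subr0.
Qed.

Lemma dc_y_generic U x y f : dcover U x y f -> generic (fun P => y P != 0).
Proof.
move=> dc; have [P [UP yP]] : exists P, U P /\ y P != 0.
  apply: NNPP => h; have [_ /eqP] : (0 : {poly k}) = 0 /\ 1 = 0 :> {poly k}; last by rewrite oner_eq0.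
  apply: (dc_free dc) => P UP; rewrite horner0 hornerC mul1r add0r; apply/eqP.
  by apply: contraT => yP; case: h; exists P.
apply: generic1 (generic_opn (opn_neq0 lX (dc_opn dc) (dc_y dc)) _) => [Q []//|].
by exists P.
Qed.

(** Composing the two comparisons shows that q divides a power of X. *)
Lemma odd_coordinates_proportional U U' x v y y' f f' : dcover U x y f -> dcover U' v y' f' ->
  inverse_charts U U' x v -> inverse_charts U' U v x ->
  exists (e l : nat) c, c != 0 /\ generic (fun P => x P ^+ e * y' P = c * x P ^+ l * y P).
Proof.
move=> dc dc' gl gl'; have gg := inverse_charts_generic gl.
have [e [q h]] := odd_coordinate_multiple dc dc' gl; have [e' [q' h']] := odd_coordinate_multiple dc' dc gl'.
pose d := size q'.
have yy := generic2 lX iX (fun P a b => conj a b) (dc_y_generic dc) (dc_y_generic dc').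
have hh := generic2 lX iX (fun P a b => conj a b) h h'.
have E : 'X^(e + d) = 'X^e' * q * recip d q' :> {poly k}.
  apply: (dc_generic_inj lX iX dc (q := 0) (q' := 0) _).1.
  apply: (generic3 lX iX) gg yy hh => P [UP UP' x0 vE xE] [yP yP'] [hP hP'].
  rewrite !horner0 !mul0r !addr0 !hornerE /= horner_recip ?leqnSn // -vE.
  apply: (mulIf (mulf_neq0 yP yP')).
  have v0 : v P != 0 by rewrite vE invr_eq0.
  transitivity (x P ^+ e' * x P ^+ d * (q.[x P] * y P) * (q'.[v P] * y' P)); last by ring.
  have vx : x P ^+ e' * v P ^+ e' = 1 by rewrite -exprMn vE divff // expr1n.
  rewrite -hP -hP' exprD.
  transitivity (x P ^+ e * x P ^+ d * (y P * y' P) * (x P ^+ e' * v P ^+ e')); last by ring.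
  by rewrite vx mulr1.
have [c [l [c0 qE]]] : exists c l, c != 0 /\ q = c *: 'X^l.
  by apply: (@dvd_Xn _ (e + d)); rewrite E mulrAC dvdp_mull.
exists e, l, c; split => //; apply: generic1 h => P ->.
by rewrite qE !hornerE.
Qed.

Lemma exp_cancel (a b : k) (i n : nat) : a * b = 1 -> (i <= n)%N -> a ^+ i * b ^+ n = b ^+ (n - i).
Proof. by move=> ab /subnKC {1}<-; rewrite exprD mulrA -exprMn ab expr1n mul1r. Qed.

Section Splitting.
Variables (U U' : X -> Prop) (x v y y' : X -> k) (f f' : {poly k}).
Hypotheses (dc : dcover U x y f) (dc' : dcover U' v y' f').
Hypotheses (gl : inverse_charts U U' x v).
Variables (e l : nat) (c : k).
Hypothesis c0 : c != 0.
Hypothesis hy : generic (fun P => x P ^+ e * y' P = c * x P ^+ l * y P).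
Let gg := inverse_charts_generic gl.

(** A coboundary for the cover by the two charts. *)
Definition splits t := exists a0 a1, [/\ reg U a0, reg U' a1 & generic (fun P => t P = a1 P - a0 P)].

Lemma splits_generic t t' : generic (fun P => t' P = t P) -> splits t -> splits t'.
Proof.
move=> tt [a0 [a1 [r0 r1 E]]]; exists a0, a1; split => //.
by apply: (generic2 lX iX) tt E => P ->.
Qed.

Lemma splits_left a : reg U a -> splits a.
Proof.
move=> ra; have oU := dc_opn dc; have oU' := dc_opn dc'.
exists (fun P => - a P), (fun _ => 0); split; [exact: regN|exact: reg_cst|].
by apply: (genericT lX iX) => P; rewrite sub0r opprK.
Qed.

Lemma splits_right a : reg U' a -> splits a.
Proof.
move=> ra; have oU := dc_opn dc; exists (fun _ => 0), a; split => //; first exact: reg_cst.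
by apply: (genericT lX iX) => P; rewrite subr0.
Qed.

Lemma splits_lin b t t' : splits t -> splits t' -> splits (fun P => b * t P + t' P).
Proof.
move=> [a0 [a1 [r0 r1 E]]] [b0 [b1 [s0 s1 E']]].
have oU := dc_opn dc; have oU' := dc_opn dc'.
exists (fun P => b * a0 P + b0 P), (fun P => b * a1 P + b1 P); split.
- by apply: (regD lX) => //; apply: (regM lX) => //; exact: reg_cst.
- by apply: (regD lX) => //; apply: (regM lX) => //; exact: reg_cst.
by apply: (generic2 lX iX) E E' => P -> ->; ring.
Qed.

Lemma splits_comb (b : nat -> k) (t : nat -> X -> k) (n : nat) :
  (forall i, b i != 0 -> splits (t i)) -> splits (fun P => \sum_(i < n) b i * t i P).
Proof.
move=> h; have s0 : splits (fun _ => 0).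
  by apply: splits_left; exact: reg_cst (dc_opn dc).
elim: n => [|n IH].
  by apply: splits_generic s0; apply: (genericT lX iX) => P; rewrite big_ord0.
have [bn|bn] := eqVneq (b n) 0.
  by apply: splits_generic IH; apply: (genericT lX iX) => P; rewrite big_ord_recr /= bn mul0r addr0.
apply: splits_generic (splits_lin (b n) (h n bn) IH).
by apply: (genericT lX iX) => P; rewrite big_ord_recr /= addrC.
Qed.

(** Term by term: x^(i-E) is regular on U or on U' according to the sign of
    i - E, and x^(i-E) y is regular on U if i >= E and, being a multiple of
    x^(i-E+e-l) y', on U' if i + e <= E + l. *)
Lemma splits_laurent t E p q :
  generic (fun P => x P ^+ E * t P = p.[x P] + q.[x P] * y P) ->
  (forall i, q`_i != 0 -> (E <= i)%N || (i + e <= E + l)%N) -> splits t.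
Proof.
move=> ht hq; have oU := dc_opn dc; have oU' := dc_opn dc'.
have rx := dc_x dc; have ry := dc_y dc; have rv := dc_x dc'; have ry' := dc_y dc'.
have s1 : splits (fun P => \sum_(i < size p) p`_i * (x P ^+ i * v P ^+ E)).
  apply: (@splits_comb (fun i => p`_i) (fun i P => x P ^+ i * v P ^+ E)) => i _.
  case: (leqP E i) => hi.
    apply: splits_generic (splits_left (reg_exp lX (i - E) oU rx)).
    apply: generic1 gg => P [UP UP' x0 vE xE]; rewrite mulrC; apply: exp_cancel => //.
    by rewrite vE mulVf.
  apply: splits_generic (splits_right (reg_exp lX (E - i) oU' rv)).
  apply: generic1 gg => P [UP UP' x0 vE xE]; apply: exp_cancel; last exact: ltnW.
  by rewrite vE divff.
have s2 : splits (fun P => \sum_(i < size q) q`_i * (x P ^+ i * v P ^+ E * y P)).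
  apply: (@splits_comb (fun i => q`_i) (fun i P => x P ^+ i * v P ^+ E * y P)) => i /hq /orP[hi|hi].
    apply: splits_generic (splits_left (regM lX oU (reg_exp lX (i - E) oU rx) ry)).
    apply: generic1 gg => P [UP UP' x0 vE xE]; congr (_ * _).
    by rewrite mulrC; apply: exp_cancel => //; rewrite vE mulVf.
  have r1 := regM lX oU' (reg_cst lX c^-1 oU') (regM lX oU' (reg_exp lX (E + l - (i + e)) oU' rv) ry').
  apply: splits_generic (splits_right r1).
  apply: (generic2 lX iX) gg hy => P [UP UP' x0 vE xE] h.
  have xv : x P * v P = 1 by rewrite vE divff.
  rewrite -(exp_cancel xv hi) !exprD.
  transitivity (c^-1 * v P ^+ l * (c * x P ^+ l * y P) * x P ^+ i * v P ^+ E); last by rewrite -h; ring.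
  have vx : v P ^+ l * x P ^+ l = 1 by rewrite -exprMn mulrC xv expr1n.
  transitivity (x P ^+ i * v P ^+ E * y P * (v P ^+ l * x P ^+ l)); first by rewrite vx mulr1.
  by field.
apply: splits_generic (splits_lin 1 s1 s2).
apply: (generic2 lX iX) gg ht => P [UP UP' x0 vE xE] h.
apply: (mulfI (expf_neq0 E x0)); rewrite h !horner_coef mul1r mulrDr !mulr_sumr !mulr_suml.
have xv : x P ^+ E * v P ^+ E = 1 by rewrite -exprMn vE divff // expr1n.
congr (_ + _); apply: eq_bigr => i _.
  by transitivity (p`_i * x P ^+ i * (x P ^+ E * v P ^+ E)); [rewrite xv mulr1|ring].
by transitivity (q`_i * x P ^+ i * y P * (x P ^+ E * v P ^+ E)); [rewrite xv mulr1|ring].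
Qed.

(** Comparison of the coefficients of y after multiplication by a power of x. *)
Lemma laurent_of_splits t E p q : splits t ->
  generic (fun P => x P ^+ E * t P = p.[x P] + q.[x P] * y P) ->
  forall i, q`_i != 0 -> (E <= i)%N || (i + e <= E + l)%N.
Proof.
move=> [a0 [a1 [r0 r1 ha]]] ht i qi.
have [p0 [q0 h0]] := dc_span dc r0; have [p1 [q1 h1]] := dc_span dc' r1.
pose d := (size p1 + size q1)%N.
have Eq : 'X^(d + e) * q = c *: ('X^(E + l) * recip d q1) - 'X^(E + d + e) * q0.
  apply: (dc_generic_inj lX iX dc (p := 'X^(d + e) * p)
    (p' := 'X^(E + e) * recip d p1 - 'X^(E + d + e) * p0) _).2.
  have gt := generic2 lX iX (fun P a b => conj a b) ht ha.
  apply: (generic3 lX iX) gg gt hy => P [UP UP' x0 vE xE] [ht' ha'] hy'.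
  have d1 : (size p1 <= d.+1)%N by rewrite /d; lia.
  have d2 : (size q1 <= d.+1)%N by rewrite /d; lia.
  rewrite !hornerE /= !horner_recip // -vE.
  transitivity (x P ^+ (d + e) * (x P ^+ E * t P)); first by rewrite ht'; ring.
  rewrite ha' h0 // h1 //.
  transitivity (x P ^+ (E + e) * (x P ^+ d * p1.[v P]) - x P ^+ (E + d + e) * p0.[x P]
    + (x P ^+ E * x P ^+ d * q1.[v P] * (x P ^+ e * y' P) - x P ^+ (E + d + e) * q0.[x P] * y P)).
    by rewrite !exprD; ring.
  by rewrite hy' !exprD; ring.
have := congr1 (fun p : {poly k} => p`_(i + (d + e))) Eq.
rewrite coefB coefZ !coefXnM coef_recip.
rewrite ltnNge leq_addl /= addnK.
case: (leqP E i) => //= lt_i.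
have -> : (i + (d + e) < E + d + e)%N by lia.
rewrite subr0; case: ltnP => [_ /eqP|le1]; first by rewrite mulr0 (negPf qi).
case: leqP => [le2 _|_ /eqP]; last by rewrite mulr0 (negPf qi).
lia.
Qed.

(** Squaring the relation between y and y'. *)
Lemma branch_recip d : (size f' <= d.+1)%N ->
  'X^(e * 2) * recip d f' = c ^+ 2 *: ('X^(l * 2 + d) * f).
Proof.
move=> sd; apply: (dc_generic_inj lX iX dc (q := 0) (q' := 0) _).1.
apply: (generic2 lX iX) gg hy => P [UP UP' x0 vE xE] h.
rewrite !horner0 !mul0r !addr0 !hornerE /= horner_recip // -vE -(dc_eq dc') // -(dc_eq dc) //.
transitivity (x P ^+ d * (x P ^+ e * y' P) ^+ 2); first by rewrite exprM; ring.
by rewrite h exprD exprM; ring.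
Qed.
End Splitting.
End TwoCharts.

(** * Cohomology from the two charts *)

Lemma left_kernel (k : fieldType) m n (M : 'M[k]_(m, n)) : (n < m)%N ->
  exists2 c : 'I_m -> k, exists i, c i != 0 & forall j, \sum_i c i * M i j = 0.
Proof.
move=> nm; have : kermx M != 0.
  rewrite kermx_eq0 /row_free; apply/eqP => r; have := rank_leq_col M; rewrite r; lia.
case/rowV0Pn => u /sub_kermxP uM u0.
exists (fun i => u 0 i) => [|j].
  apply: NNPP => h; case/eqP: u0; apply/rowP => i; rewrite mxE; apply/eqP.
  by apply: contraT => ui; case: h; exists i.
by have := congr1 (fun N : 'rV_n => N 0 j) uM; rewrite !mxE.
Qed.

Section Cohomology.
Variables (k : closedFieldType) (X : fun_space k).
Hypothesis lX : lawful X.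
Hypothesis iX : irreducible X.
Hypothesis e11 : 11%:R = 0 :> k.
Implicit Types (g w t r : X -> k) (P Q : X) (p q : {poly k}).

Let two_neq0 : 2%:R != 0 :> k.
Proof. by rewrite natr_eq0_11. Qed.

(** A fixed member [l0] of the common refinement shows that the principal parts
    [s i0 i] and [t j0 j] differ by one rational function. *)
Lemma cohomologous_ext (I J : Type) (V : I -> X -> Prop) (s : I -> I -> X -> k)
    (W : J -> X -> Prop) (t : J -> J -> X -> k) i0 j0 :
  open_cover V -> cocycle V s -> open_cover W -> cocycle W t ->
  nonempty (V i0) -> nonempty (W j0) -> cohomologous V s W t ->
  exists r, forall P i j, V i P -> W j P -> ext P (fun z => s i0 i z - t j0 j z - r z).
Proof.
move=> cV cs cW ct nV nW [L [O [a [b [h [cO sub rh hE]]]]]].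
have [oV _] := cV; have [oW _] := cW; have [oO covO] := cO.
have [x0 _] := iX.1; have [l0 Ol0] := covO x0; have [Vl0 Wl0] := sub l0 x0 Ol0.
exists (fun z => s i0 (a l0) z - t j0 (b l0) z - h l0 z) => P i j ViP WjP.
have [l Ol] := covO P; have [Vl Wl] := sub l P Ol.
have e1 : ext P (fun z => h l z + s (a l) i z - t (b l) j z).
  apply: extB => //; last exact: (cocycle_ext lX iX cW ct Wl WjP).
  by apply: extD => //; [exact: (ext_reg lX iX (oO l) Ol (rh l))|exact: (cocycle_ext lX iX cV cs Vl ViP)].
have nVl0 : nonempty (V (a l0)) by exists x0.
have nWl0 : nonempty (W (b l0)) by exists x0.
have nVl : nonempty (V (a l)) by exists P.
have nWl : nonempty (W (b l)) by exists P.
have c1 := cocycle_generic lX iX cV cs nV nVl0 nVl.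
have c2 := cocycle_generic lX iX cV cs nV nVl (ex_intro _ P ViP).
have d1 := cocycle_generic lX iX cW ct nW nWl0 nWl.
have d2 := cocycle_generic lX iX cW ct nW nWl (ex_intro _ P WjP).
apply: ext_generic e1 => //.
have cc := generic2 lX iX (fun P a b => conj a b) c1 c2.
have dd := generic2 lX iX (fun P a b => conj a b) d1 d2.
have hh : generic (fun z => s (a l0) (a l) z - t (b l0) (b l) z = h l z - h l0 z).
  have nO : nonempty (O l) by exists P.
  have nO0 : nonempty (O l0) by exists x0.
  by apply: (generic2 lX iX) (generic_opn (oO l0) nO0) (generic_opn (oO l) nO) => z; exact: hE.
apply: (generic3 lX iX) cc dd hh => z [C1 C2] [D1 D2] H.
by rewrite C2 C1 D2 D1; apply: (subr_congr H); ring.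
Qed.

(** A global rational function with the principal parts of the cocycle splits it. *)
Lemma coboundary (I : Type) (V : I -> X -> Prop) (s : I -> I -> X -> k) i0 r :
  open_cover V -> cocycle V s -> nonempty (V i0) ->
  (forall P i, V i P -> ext P (fun z => r z + s i0 i z)) -> cohomologous0 V s.
Proof.
move=> cV cs nV hr; have [oV _] := cV; have [rs _] := cs.
have/ex_choice[h hh] i : exists h, reg (V i) h /\
    (nonempty (V i) -> generic (fun z => r z + s i0 i z = h z)).
  have [ne|em] := classic (nonempty (V i)).
    have [h [rh e]] := ext_glue lX iX (oV i) ne (fun P ViP => hr P i ViP).
    by exists h.
  by exists (fun _ => 0); split => //; exact: (reg_cst lX _ (oV i)).
exists I, V, id, id, h; split => //; first by move=> i; have [] := hh i.
move=> i j x Vi Vj; rewrite subr0.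
have oI := opnI lX (oV i) (oV j).
have ni : nonempty (V i) by exists x.
have nj : nonempty (V j) by exists x.
have hg : generic (fun z => s i j z = h j z - h i z).
  have gij := cocycle_generic lX iX cV cs nV ni nj.
  by apply: (generic3 lX iX) gij ((hh i).2 ni) ((hh j).2 nj) => z E <- <-; rewrite E; ring.
apply: (reg_generic lX iX oI _ _ hg (conj Vi Vj)); first exact: rs.
by apply: (regB lX) => //; [apply: (reg_sub lX (oV j) oI (hh j).1) => z []|apply: (reg_sub lX (oV i) oI (hh i).1) => z []].
Qed.

Lemma comb_ext (g : nat) (I : Type) (W : I -> X -> Prop) (b : 'I_g -> I -> I -> X -> k) (r : 'I_g -> X -> k)
    (c : 'I_g -> k) i0 P i :
  (forall n, ext P (fun z => r n z + b n i0 i z)) ->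
  ext P (fun z => \sum_n c n * r n z + \sum_n c n * b n i0 i z).
Proof.
move=> h; have e : ext P (fun z => \sum_(n <- enum 'I_g) c n * (r n z + b n i0 i z)).
  by apply: ext_sum => // n; apply: extM => //; exact: ext_cst.
apply: ext_generic e => //; apply: (genericT lX iX) => z.
by rewrite big_enum -big_split; apply: eq_bigr => n _; rewrite mulrDr.
Qed.

Lemma comb_cocycle (g : nat) (I : Type) (W : I -> X -> Prop) (b : 'I_g -> I -> I -> X -> k) (c : 'I_g -> k) :
  open_cover W -> (forall n, cocycle W (b n)) ->
  cocycle W (fun i j x => \sum_n c n * b n i j x).
Proof.
move=> [oW _] cb; split=> [i j|i j m x Wi Wj Wm].
  have oI := opnI lX (oW i) (oW j).
  apply: (reg_eq lX oI (f := fun x => \sum_(n <- enum 'I_g) c n * b n i j x)).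
    apply: reg_sum => // n; apply: (regM lX) => //; first exact: reg_cst.
    exact: (cb n).1.
  by move=> x _; rewrite big_enum.
rewrite -big_split; apply: eq_bigr => n _ /=; rewrite -mulrDr.
by congr (_ * _); apply: (cb n).2.
Qed.

Section TwoCharts.
Variables (U U' : X -> Prop) (x v y y' : X -> k) (f f' : {poly k}).
Hypotheses (dc : dcover U x y f) (dc' : dcover U' v y' f').
Hypotheses (gl : inverse_charts U U' x v) (cov : forall P, U P \/ U' P).
Variables (e l : nat) (c : k).
Hypothesis c0 : c != 0.
Hypothesis hy : generic (fun P => x P ^+ e * y' P = c * x P ^+ l * y P).
Let gg := inverse_charts_generic lX iX gl.
Let oU := dc_opn dc.
Let oU' := dc_opn dc'.
Let nU := dc_nonempty dc.
Let nU' := dc_nonempty dc'.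

(** The classes of a basis are represented on the overlap by functions t_n.  If
    e - l <= g, the obstruction to splitting consists of at most g - 1
    coefficients, so that a nontrivial combination of the basis splits. *)
Lemma h1_dim_lower (g : nat) : h1_dim X g -> (0 < g)%N -> (l + g < e)%N.
Proof.
move=> [I [W [b [cW cb _ indep]]]] g0; rewrite ltnNge; apply/negP => le_e.
have [oW covW] := cW; have [P0 _] := iX.1; have [i0 Wi0] := covW P0.
have nW : nonempty (W i0) by exists P0.
have/ex_choice[r0 hr0] n := chart_acyclic lX iX two_neq0 dc cW (cb n) nW.
have/ex_choice[r1 hr1] n := chart_acyclic lX iX two_neq0 dc' cW (cb n) nW.
have [Ux _ _ _ _] := gl.
have/ex_choice[E] n : exists E : nat, exists p q,
    generic (fun P => x P ^+ E * (r1 n P - r0 n P) = p.[x P] + q.[x P] * y P).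
  apply: (laurent lX iX dc) => P UP xP; have [i Wi] := covW P.
  apply: ext_generic (extB lX iX (hr1 n P i (Ux P UP xP) Wi) (hr0 n P i UP Wi)) => //.
  by apply: (genericT lX iX) => z; ring.
case/ex_choice => p /ex_choice[q hpq].
pose N := (\sum_n E n)%N.
have leE n : (E n <= N)%N by rewrite /N (bigD1 n) //= leq_addr.
pose q' n := 'X^(N - E n) * q n; pose p' n := 'X^(N - E n) * p n.
have hN n : generic (fun P => x P ^+ N * (r1 n P - r0 n P) = (p' n).[x P] + (q' n).[x P] * y P).
  apply: generic1 (hpq n) => P h.
  have -> : x P ^+ N = x P ^+ (N - E n) * x P ^+ E n by rewrite -exprD subnK.
  by rewrite -mulrA h !hornerE /=; ring.
have gm : (g.-1 < g)%N by rewrite prednK.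
have [d [n0 dn0] dM] := left_kernel (\matrix_(n < g, j < g.-1) (q' n)`_(N - j.+1)) gm.
have [] : splits U U' (fun P => \sum_n d n * r1 n P - \sum_n d n * r0 n P).
  apply: (splits_laurent lX iX dc dc' gl c0 hy (E := N) (p := \sum_n d n *: p' n) (q := \sum_n d n *: q' n)).
    apply: generic1 (generic_all lX iX hN) => P h.
    rewrite -sumrB mulr_sumr !horner_sum mulr_suml -big_split; apply: eq_bigr => n _ /=.
    by rewrite -mulrBr mulrCA h !hornerE /=; ring.
  move=> i; apply: contraR; rewrite negb_or -!ltnNge => /andP[lt_iN lt].
  have lt_j : (N - i.+1 < g.-1)%N by lia.
  have := dM (Ordinal lt_j); rewrite coef_sum => dj; apply/eqP; rewrite -[RHS]dj.
  apply: eq_bigr => n _; rewrite coefZ mxE /=; congr (_ * nth _ _ _); lia.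
move=> a0 [a1 [ra0 ra1 ha]].
case/negP: dn0; apply/eqP; apply: indep.
apply: (coboundary (i0 := i0) (r := fun P => \sum_n d n * r0 n P - a0 P)) => //.
  exact: comb_cocycle.
move=> P i Wi; case: (cov P) => [UP|UP].
  have e1 := comb_ext W d (fun n => hr0 n P i UP Wi).
  apply: ext_generic (extB lX iX e1 (ext_reg lX iX oU UP ra0)) => //.
  by apply: (genericT lX iX) => z; ring.
have e1 := comb_ext W d (fun n => hr1 n P i UP Wi).
apply: ext_generic (extB lX iX e1 (ext_reg lX iX oU' UP ra1)) => //.
by apply: generic1 ha => z h; apply: (subr_congr (esym h)); ring.
Qed.

Definition two_cover (b : bool) : X -> Prop := if b then U' else U.
Definition two_cocycle t (a b : bool) : X -> k :=
  fun P => if a == b then 0 else if b then t P else - t P.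

Lemma two_coverP : open_cover two_cover.
Proof.
split=> [[]|P] //.
by case: (cov P) => h; [exists false|exists true].
Qed.

Let oUU' := opnI lX oU oU'.

Lemma two_cocycleP t : reg (fun P => U P /\ U' P) t -> cocycle two_cover (two_cocycle t).
Proof.
move=> rt; split=> [i j|].
  have oI := opnI lX (two_coverP.1 i) (two_coverP.1 j).
  case: i j oI => [] [] oI; rewrite /two_cocycle /=; try exact: reg_cst.
    by apply: regN => //; apply: (reg_sub lX oUU' oI rt) => z [].
  by apply: (reg_sub lX oUU' oI rt).
by move=> [] [] [] P _ _ _; rewrite /two_cocycle /= ?addr0 ?add0r ?subrr ?addNr.
Qed.

Lemma splits_of_cohomologous t : reg (fun P => U P /\ U' P) t ->
  cohomologous0 two_cover (two_cocycle t) -> splits U U' t.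
Proof.
move=> rt h; have ct := two_cocycleP rt.
have c00 : cocycle two_cover (fun _ _ _ => 0 : k).
  split=> [i j|]; last by move=> *; rewrite addr0.
  by apply: reg_cst => //; apply: opnI => //; exact: two_coverP.1.
have nc : nonempty (two_cover false) by [].
have [r hr] := cohomologous_ext two_coverP ct two_coverP c00 nc nc h.
have [a0 [ra0 h0]] : exists g, reg U g /\ generic (fun z => - r z = g z).
  apply: (ext_glue lX iX oU nU) => P UP.
  apply: ext_generic (hr P false false UP UP) => //; apply: (genericT lX iX) => z.
  by rewrite /two_cocycle /= subrr sub0r.
have [a1 [ra1 h1]] : exists g, reg U' g /\ generic (fun z => t z - r z = g z).
  apply: (ext_glue lX iX oU' nU') => P UP.
  apply: ext_generic (hr P true true UP UP) => //; apply: (genericT lX iX) => z.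
  by rewrite /two_cocycle /= subr0.
exists a0, a1; split => //.
by apply: (generic2 lX iX) h0 h1 => z <- <-; ring.
Qed.

Lemma reg_monomial j : reg (fun P => U P /\ U' P) (fun P => v P ^+ j * y P).
Proof.
apply: (regM lX oUU').
  by apply: reg_exp => //; apply: (reg_sub lX oU' oUU' (dc_x dc')) => z [].
by apply: (reg_sub lX oU oUU' (dc_y dc)) => z [].
Qed.

(** Otherwise y v, ..., y v^(g+1) have independent classes: some combination
    of them is cohomologous to 0, hence splits, against [laurent_of_splits]. *)
Lemma h1_dim_upper (g : nat) : h1_dim X g -> (e <= l + g.+1)%N.
Proof.
move=> [I [W [b [cW cb spanH _]]]]; rewrite leqNgt; apply/negP => lt_e.
have [oW covW] := cW; have [P0 _] := iX.1; have [j0 Wj0] := covW P0.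
have nW : nonempty (W j0) by exists P0.
pose t (j : 'I_g.+1) P := v P ^+ j.+1 * y P.
have ct j := two_cocycleP (reg_monomial j.+1) : cocycle two_cover (two_cocycle (t j)).
have/ex_choice[C hC] j := spanH _ _ _ two_coverP (ct j).
have nc : nonempty (two_cover false) by [].
have/ex_choice[r hr] j := cohomologous_ext two_coverP (ct j) cW (comb_cocycle (C j) cW cb) nc nW (hC j).
have [d [m dm] dC] := left_kernel (\matrix_(j < g.+1, n < g) C j n) (leqnn g.+1).
have hd P i : two_cover i P -> ext P (fun z => \sum_j d j * two_cocycle (t j) false i z - \sum_j d j * r j z).
  move=> UiP; have [w WwP] := covW P.
  have e1 : ext P (fun z => \sum_(j <- enum 'I_g.+1) d j * (two_cocycle (t j) false i z -
      \sum_n C j n * b n j0 w z - r j z)).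
    by apply: ext_sum => // j; apply: extM => //; [exact: ext_cst|exact: hr].
  apply: ext_generic e1 => //; apply: (genericT lX iX) => z; rewrite big_enum.
  under eq_bigr do rewrite !mulrBr.
  rewrite !sumrB; congr (_ - _); rewrite [X in _ - X](_ : _ = 0) ?subr0 //.
  under eq_bigr do rewrite mulr_sumr.
  rewrite exchange_big big1 // => n _; under eq_bigr do rewrite mulrA.
  rewrite -mulr_suml; have := dC n; under eq_bigr do rewrite mxE.
  by move=> ->; rewrite mul0r.
have sT : splits U U' (fun P => \sum_j d j * t j P).
  have [a0 [ra0 h0]] : exists a, reg U a /\ generic (fun z => - (\sum_j d j * r j z) = a z).
    apply: (ext_glue lX iX oU nU) => P UP.
    apply: ext_generic (hd P false UP) => //; apply: (genericT lX iX) => z.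
    by rewrite /two_cocycle /= [X in _ = X - _]big1 ?sub0r // => j _; rewrite mulr0.
  have [a1 [ra1 h1]] : exists a, reg U' a /\
      generic (fun z => \sum_j d j * t j z - \sum_j d j * r j z = a z).
    apply: (ext_glue lX iX oU' nU') => P UP.
    by apply: ext_generic (hd P true UP) => //; apply: (genericT lX iX) => z.
  exists a0, a1; split => //.
  by apply: (generic2 lX iX) h0 h1 => z <- <-; ring.
have := laurent_of_splits lX iX two_neq0 dc dc' gl c0 hy (E := g.+1) (p := 0)
  (q := \sum_(j < g.+1) d j *: 'X^(g - j)) sT.
move=> /(_ _ (g - m)%N) nec; suff : (g.+1 <= g - m)%N || (g - m + e <= g.+1 + l)%N.
  by have := ltn_ord m; lia.
apply: nec.
  apply: generic1 gg => P [UP UP' x0 vE xE].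
  rewrite horner0 add0r horner_sum mulr_sumr mulr_suml; apply: eq_bigr => j _.
  have jg : (j <= g)%N by rewrite -ltnS.
  rewrite !hornerE /= /t vE.
  have -> : x P ^+ g.+1 = x P ^+ (g - j) * x P ^+ j.+1 by rewrite -exprD addnS subnK.
  have xv : x P ^+ j.+1 * (x P)^-1 ^+ j.+1 = 1 by rewrite -exprMn divff // expr1n.
  transitivity (d j * x P ^+ (g - j) * y P * (x P ^+ j.+1 * (x P)^-1 ^+ j.+1)); first by ring.
  by rewrite xv mulr1.
rewrite coef_sum (bigD1 m) //= big1 ?addr0 => [|j jm]; first by rewrite coefZ coefXn eqxx mulr1.
rewrite coefZ coefXn; case: eqP => [E|]; last by rewrite mulr0.
case/eqP: jm; apply: val_inj => /=; have := ltn_ord m; have := ltn_ord j; lia.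
Qed.

(** For j between 1 and 4, the Frobenius image of the class of y/x^j is
    f^5 y / x^(11j), and the coefficients of f^5 at 11j - 4, ..., 11j - 1 obstruct its
    splitting. *)
Lemma superspecial_cartier : e = (l + 5)%N -> (size f <= 11)%N -> superspecial 11 X -> cartier_null (f ^+ 5).
Proof.
move=> el sf [_ ss] i nok; apply/eqP; apply: contraNT nok => fi.
have i51 : (i < 51)%N.
  rewrite ltnNge; apply: contra fi => i51; rewrite nth_default //.
  exact: leq_trans (@size_expn_leq _ 10 f 5 sf) i51.
rewrite /exponent_allowed i51 ltnNge; apply/negP => i7.
(* i = 11 j - (11 - i %% 11), where 1 <= 11 - i %% 11 <= 4 *)
pose j := (i %/ 11).+1; pose t P := v P ^+ j * y P.
have oI := oUU'.
have rt : reg (fun P => U P /\ U' P) (fun P => t P ^+ 11) by apply: reg_exp => //; exact: reg_monomial.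
have st : splits U U' (fun P => t P ^+ 11).
  apply: splits_of_cohomologous => //.
  have <- : frobenius 11 (two_cocycle t) = two_cocycle (fun P => t P ^+ 11).
    apply: functional_extensionality => a; apply: functional_extensionality => b.
    apply: functional_extensionality => P; rewrite /frobenius /two_cocycle.
    case: eqP => _; first by rewrite expr0n.
    by case: b => //; rewrite exprNn -signr_odd mulN1r.
  exact: ss two_coverP (two_cocycleP (reg_monomial j)).
suff : (11 * j <= i)%N || (i + e <= 11 * j + l)%N by rewrite el /j; lia.
apply: (laurent_of_splits lX iX two_neq0 dc dc' gl c0 hy (p := 0) (q := f ^+ 5) st) => //.
apply: generic1 gg => P [UP UP' x0 vE xE].
rewrite horner0 add0r horner_exp -(dc_eq dc) // /t vE.
have xv : x P ^+ (11 * j) * ((x P)^-1 ^+ j) ^+ 11 = 1 by rewrite -exprM mulnC -exprMn divff // expr1n.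
by rewrite exprMn mulrA xv; ring.
Qed.

Theorem genus4_charts_absurd : superspecial 11 X -> genus X 4 -> False.
Proof.
move=> ss g4; have el : e = (l + 5)%N.
  by have := h1_dim_upper g4; have := h1_dim_lower g4 isT; lia.
pose d := (size f' + 10)%N.
have br := branch_recip lX iX dc dc' gl hy (leq_trans (leq_addr 10 (size f')) (leqnSn _)).
have co j : (c ^+ 2 * f`_j) = if (j <= 10)%N then f'`_(10 - j) else 0.
  have := congr1 (fun p : {poly k} => p`_(l * 2 + d + j)) br; rewrite coefZ !coefXnM coef_recip.
  have -> : (l * 2 + d + j < e * 2)%N = false by rewrite el /d; lia.
  have -> : (l * 2 + d + j < l * 2 + d)%N = false by lia.
  rewrite addKn => <-; case: leqP => h1; case: leqP => h2 //; try by (exfalso; move: h1 h2; rewrite el /d; lia).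
  by congr nth; rewrite el /d; lia.
have c2 : c ^+ 2 != 0 by rewrite expf_neq0.
have sf : (size f <= 11)%N.
  apply/leq_sizeP => j j11; apply: (mulfI c2); rewrite co mulr0 ifF //; lia.
apply: (genus4_absurd e11 sf _ (dc_sqf dc) (superspecial_cartier el sf ss)).
have := co 9; have := co 10; rewrite /= subnn => c10 c9.
have [f10|] := eqVneq f`_10 0; last by rewrite orbT.
rewrite orbF; have r0 : root f' 0 by rewrite rootE horner_coef0 -c10 f10 mulr0.
have := dc_sqf dc' r0; rewrite rootE horner_coef0 coef_deriv mulr1n.
have -> : f'`_1 = c ^+ 2 * f`_9 by rewrite c9.
by rewrite mulf_eq0 (negPf c2).
Qed.
End TwoCharts.
End Cohomology.

(** * Morphisms, affine open sets and the projective line *)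

Section Morphisms.
Variable k : closedFieldType.

Lemma reg_mpoly (X : fun_space k) (U : X -> Prop) m (h : 'I_m -> X -> k) (F : {mpoly k[m]}) :
  lawful X -> opn U -> (forall i, reg U (h i)) -> reg U (fun x => F.@[fun i => h i x]).
Proof.
move=> lX oU rh.
have rprod (s : seq 'I_m) (e : 'I_m -> nat) : reg U (fun x => \prod_(i <- s) h i x ^+ e i).
  elim: s => [|i s IH]; first by apply: (reg_eq lX oU (reg_cst lX 1 oU)) => x _; rewrite big_nil.
  apply: (reg_eq lX oU (regM lX oU (reg_exp lX (e i) oU (rh i)) IH)) => x _.
  by rewrite big_cons.
apply: (reg_eq lX oU (f := fun x => \sum_(m0 <- msupp F) F@_m0 * \prod_(i <- enum 'I_m) h i x ^+ m0 i)).
  by apply: reg_sum => // m0; apply: (regM lX) => //; exact: reg_cst.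
by move=> x _; rewrite mevalE; apply: eq_bigr => m0 _; rewrite big_enum.
Qed.

(** A map into a subspace of a quotient space is a morphism as soon as the forms
    pull back to regular functions, up to the degree-th power of a nowhere
    vanishing factor, which cancels in quotients. *)
Lemma morphism_to_quotient (T : Type) (forms : nat -> (T -> k) -> Prop)
  (formM : forall d e f g, forms d f -> forms e g -> forms (d + e)%N (fun x => f x * g x))
  (Z : quotient_space forms -> Prop) (Y : fun_space k) (phi : Y -> sub_space Z) (lam : Y -> k) :
  lawful Y -> (forall y, lam y != 0) ->
  (forall d f, forms d f -> exists g, reg (fun _ : Y => True) g /\
    forall y, f (sval (phi y)) = lam y ^+ d * g y) ->
  morphism phi.
Proof.
move=> lY lam0 pull W [W' oW' WW'].
have oT := opnT lY.
have openP (V : quotient_space forms -> Prop) : opn V -> opn (fun y => V (sval (phi y))).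
  move=> /quotient_opnP oV; apply: (opn_local lY) => y /oV[d [f [df fy fV]]].
  have [g [rg gE]] := pull d f df.
  exists (fun y => True /\ g y != 0); split; first exact: opn_neq0.
    by split => //; move: fy; rewrite gE mulf_eq0 negb_or => /andP[].
  by move=> z [_ gz]; apply: fV; rewrite gE mulf_neq0 // expf_neq0.
have oW : opn (fun y => W (phi y)).
  by rewrite (_ : (fun y => _) = (fun y => W' (sval (phi y)))); [exact: openP|apply: predext => y; exact: WW'].
split => // g rg; apply: (reg_local lY oW) => y Wy.
have [V [g' [oV Vy rg' gg']]] := rg (phi y) Wy.
have [V' [d [a [b [oV' V'y da db ab]]]]] := rg' _ Vy.
have [a' [ra aE]] := pull d a da; have [b' [rb bE]] := pull d b db.
have oVV : opn (fun y => V (sval (phi y)) /\ V' (sval (phi y))).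
  exact: (opnI lY (openP _ oV) (openP _ oV')).
have nb z : V (sval (phi z)) /\ V' (sval (phi z)) -> b' z != 0.
  move=> [Vz V'z]; have [bz _] := ab _ Vz V'z.
  by move: bz; rewrite bE mulf_eq0 negb_or => /andP[].
exists (fun y => V (sval (phi y)) /\ V' (sval (phi y))), (fun y => a' y * (b' y)^-1); split => //.
  apply: (regM lY oVV); first exact: (reg_sub lY oT oVV ra).
  by apply: (regV lY oVV) nb; exact: (reg_sub lY oT oVV rb).
move=> z Wz Vz; rewrite gg' //; last by case: Vz.
have [_ ->] := ab _ Vz.1 Vz.2; rewrite aE bE.
have := nb z Vz; have := expf_neq0 d (lam0 z) => l0 b0.
by field; rewrite l0 b0.
Qed.

(** Near each point of an affine open set, regular functions are quotients of
    functions that are regular on all of it. *)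
Lemma affine_localizes (X : fun_space k) (U : X -> Prop) :
  lawful X -> opn U -> affine (sub_space U) -> localizes U.
Proof.
move=> lX oU [m [Z [_ [phi [psi [mphi mpsi phiK psiK]]]]]] W f P oW WP UP rf.
pose extend (h : sub_space U -> k) (x : X) : k :=
  match excluded_middle_informative (U x) with
  | left Ux => h (exist _ x Ux) | right _ => 0 end.
have extendE h (y : sub_space U) : extend h (sval y) = h y.
  rewrite /extend; case: excluded_middle_informative => [Ux|[]]; last by case: y.
  by case: y Ux => y Uy /= Ux; rewrite (proof_irrelevance _ Ux Uy).
have rE (F : {mpoly k[m]}) : reg U (extend (fun y => F.@[fun i => (sval (phi y) : 'rV[k]_m) 0 i])).
  have lA := lawful_affine k m.
  have [_ h] := mphi (fun _ => True) (opnT (lawful_sub Z lA)).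
  have rF : reg (fun _ : sub_space Z => True) (fun z => F.@[fun i => (sval z : 'rV[k]_m) 0 i]).
    move=> /= z _; exists (fun _ => True), (fun p : 'rV[k]_m => F.@[fun i => p 0 i]).
    split => //; first exact: (opnT lA).
    move=> p _; exists (fun _ => True), 0%N, (fun p : 'rV[k]_m => F.@[fun i => p 0 i]), (fun _ => 1).
    split => //; [exact: (opnT lA)|by exists F|by exists 1 => p'; rewrite meval1|].
    by move=> p' _ _; rewrite oner_neq0 divr1.
  apply: (reg_local lX oU) => x Ux.
  have [V [g [oV Vx rg gE]]] := h _ rF (exist _ x Ux) I.
  exists V, g; split => // y Uy Vy.
  by rewrite -[y]/(sval (exist U y Uy)) extendE gE.
pose P' : sub_space U := exist _ P UP.
pose W1 (y : sub_space U) := W (sval y).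
have oW1 : opn W1 by exists W.
have rf1 : reg W1 (fun y => f (sval y)).
  by move=> /= y Wy; exists W, f; split.
have [[W2 oW2 WW2] h] := mpsi W1 oW1.
have W1P : W1 (psi (phi P')) by rewrite phiK.
have [V [g [oV VP rg gE]]] := h _ rf1 (phi P') W1P.
have [V' [d [a [b [oV' V'P [A hA] [B hB] ab]]]]] := rg _ VP.
have /quotient_opnP oI := opnI (lawful_affine k m) (opnI (lawful_affine k m) oV oV') oW2.
have [_ [c [[C hC] cP cW]]] := oI _ (conj (conj VP V'P) ((WW2 _).1 W1P)).
exists (extend (fun y => (A * C).@[fun i => (sval (phi y) : 'rV[k]_m) 0 i])).
exists (extend (fun y => (B * C).@[fun i => (sval (phi y) : 'rV[k]_m) 0 i])).
split => //.
  rewrite -[P]/(sval P') extendE mevalM -hB -hC mulf_neq0 //.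
  exact: (ab _ VP V'P).1.
move=> y Uy; rewrite -[y]/(sval (exist U y Uy)) !extendE !mevalM -!hA -!hB -!hC.
set y' := exist U y Uy.
rewrite mulf_eq0 negb_or => /andP[by0 cy0].
have [[Vy V'y] W2y] := cW _ cy0.
have W1y : W1 (psi (phi y')) by apply/WW2.
have := gE (phi y') W1y Vy; rewrite phiK => ->.
move: W1y; rewrite phiK => W1y; split => //.
by have [_ ->] := ab _ Vy V'y; field; rewrite cy0 by0.
Qed.
End Morphisms.

Section ProjectiveLine.
Variable k : closedFieldType.
Local Notation P1 := (proj_space k 1).
Implicit Types (i : 'I_2) (P : P1).

Let lP : lawful P1 := lawful_proj k 1.

Definition chart_set i (P : P1) : Prop := hcoord P i != 0.
Definition chart_coord i (P : P1) : k := hcoord P (rev_ord i) / hcoord P i.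

Lemma rev_ord2 i : rev_ord i != i.
Proof. by case: i => [[|[|]]]. Qed.

Lemma ord2_case i j : j = i \/ j = rev_ord i.
Proof.
by case: i j => [[|[|//]] hi] [[|[|//]] hj]; [left|right|right|left]; apply: val_inj.
Qed.

Lemma big_ord2 (R : Type) (idx : R) (op : Monoid.com_law idx) i (h : 'I_2 -> R) :
  \big[op/idx]_j h j = op (h i) (h (rev_ord i)).
Proof.
rewrite (bigD1 i) //= (big_pred1 (rev_ord i)) // => j.
case: (ord2_case i j) => -> /=; first by rewrite eqxx eq_sym (negPf (rev_ord2 i)).
by rewrite eqxx rev_ord2.
Qed.

Lemma hcoord_form i : exists2 F : {mpoly k[2]}, F \is 1.-homog & forall P, hcoord P i = F.@[hcoord P].
Proof. by exists 'X_i => [|P]; [rewrite dhomogX; apply/eqP; exact: mdeg1|rewrite mevalXU]. Qed.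

Lemma opn_chart_set i : opn (chart_set i).
Proof.
apply/quotient_opnP => P Pi; exists 1%N, (fun P => hcoord P i); split => //.
exact: hcoord_form.
Qed.

Lemma reg_chart_coord i : reg (chart_set i) (chart_coord i).
Proof.
move=> /= P Pi; exists (chart_set i), 1%N, (fun P => hcoord P (rev_ord i)), (fun P => hcoord P i).
by split => //; [exact: opn_chart_set|exact: hcoord_form|exact: hcoord_form].
Qed.

(** The form F with the i-th variable set to 1. *)
Definition dehom i (F : {mpoly k[2]}) : {poly k} :=
  \sum_(m <- msupp F) F@_m *: 'X^(m (rev_ord i)).

Lemma dehomP i d (F : {mpoly k[2]}) (h : 'I_2 -> k) : F \is d.-homog -> h i != 0 ->
  F.@[h] = h i ^+ d * (dehom i F).[h (rev_ord i) / h i].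
Proof.
move=> /dhomogP hF hi; rewrite mevalE /dehom horner_sum mulr_sumr !big_seq.
apply: eq_bigr => m /hF md.
have -> : d = (m i + m (rev_ord i))%N by rewrite -md; exact: etrans (mdegE m) (big_ord2 _ i _).
rewrite (big_ord2 _ i) /= hornerZ hornerXn exprMn exprVn exprD.
by field; rewrite expf_neq0.
Qed.

Let point_vec i c : 'rV[k]_2 := \row_j (if j == i then 1 else c).

Let point_vec_neq0 i c : point_vec i c != 0.
Proof.
apply/eqP => /rowP/(_ i); rewrite !mxE eqxx => /eqP; rewrite oner_eq0 //.
Qed.

Lemma point_dim i c : \dim <[point_vec i c]>%VS == 1%N.
Proof. by rewrite dim_vline point_vec_neq0. Qed.

Definition chart_point i c : P1 := exist _ <[point_vec i c]>%VS (point_dim i c).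

Lemma chart_pointE i c : hcoord (chart_point i c) i != 0 /\
  hcoord (chart_point i c) (rev_ord i) = hcoord (chart_point i c) i * c.
Proof.
have /vlineP[a aE] := memv_pick <[point_vec i c]>%VS.
have : vpick <[point_vec i c]>%VS != 0.
  by rewrite vpick0 -dimv_eq0 dim_vline point_vec_neq0.
rewrite /hcoord /= aE scaler_eq0 negb_or => /andP[a0 _].
by rewrite !mxE eqxx (negPf (rev_ord2 i)) mulr1.
Qed.

Lemma chart_point_in i c : chart_set i (chart_point i c).
Proof. by case: (chart_pointE i c). Qed.

Lemma chart_pointK i c : chart_coord i (chart_point i c) = c.
Proof. by case: (chart_pointE i c) => h0 h; rewrite /chart_coord h mulrC mulKf. Qed.

Lemma chart_coordK i P : chart_set i P -> chart_point i (chart_coord i P) = P.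
Proof.
case: P => l hl Pi; apply: val_inj => /=; apply/eqP; rewrite eqEdim.
set P := exist _ l hl in Pi *.
have -> : point_vec i (chart_coord i P) = (hcoord P i)^-1 *: vpick l.
  apply/rowP => j; rewrite !mxE; case: (ord2_case i j) => ->.
    by rewrite eqxx /hcoord /= mulVf.
  by rewrite (negPf (rev_ord2 i)) mulrC.
rewrite -memvE memvZ ?memv_pick //= (eqP hl) dim_vline scaler_eq0 invr_eq0 negb_or Pi /=.
by rewrite vpick0 -dimv_eq0 (eqP hl).
Qed.

Lemma affine_chart_set i : affine (sub_space (chart_set i)).
Proof.
exists 1%N, (fun _ => True).
have lA := lawful_affine k 1.
split.
  by apply/quotient_opnP => x [].
pose phi (P : sub_space (chart_set i)) : sub_space (fun _ : affine_space k 1 => True) :=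
  exist _ (const_mx (chart_coord i (sval P)) : 'rV_1) I.
pose psi (c : sub_space (fun _ : affine_space k 1 => True)) : sub_space (chart_set i) :=
  exist _ (chart_point i ((sval c : 'rV_1) 0 0)) (chart_point_in i _).
have lS := lawful_sub (chart_set i) lP.
have lT := lawful_sub (fun _ : affine_space k 1 => True) lA.
exists phi, psi; split.
- apply: (@morphism_to_quotient k _ _ _ _ _ phi (fun _ => 1) lS).
  + by move=> _ _ f g [F hF] [G hG]; exists (F * G) => x; rewrite mevalM hF hG.
  + by move=> _; exact: oner_neq0.
  move=> d f [F hF]; exists (fun P : sub_space (chart_set i) => F.@[fun _ => chart_coord i (sval P)]); split.
    apply: (reg_mpoly (h := fun _ (P : sub_space (chart_set i)) => chart_coord i (sval P)) F lS (opnT lS)) => j /= P _.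
    exists (chart_set i), (chart_coord i); split => //; [exact: opn_chart_set|exact: (valP P)|exact: reg_chart_coord].
  by move=> P; rewrite expr1n mul1r hF; apply: meval_eq => j; rewrite mxE.
- apply: (@morphism_to_quotient k _ _ _ _ _ psi (fun c => hcoord (sval (psi c)) i) lT).
  + by move=> d e f g [F hF1 hF] [G hG1 hG]; exists (F * G) => [|x]; rewrite ?dhomogM // mevalM hF hG.
  + by move=> c; exact: chart_point_in.
  move=> d f [F hF1 hF]; exists (fun c => (dehom i F).[(sval c : 'rV_1) 0 0]); split.
    apply: reg_poly => //; first exact: opnT.
    move=> /= c _; exists (fun _ => True), (fun p : 'rV[k]_1 => p 0 0); split => //; first exact: (opnT lA).
    move=> p _; exists (fun _ => True), 0%N, (fun p : 'rV[k]_1 => p 0 0), (fun _ => 1).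
    split => //; [exact: (opnT lA)|by exists 'X_0 => p'; rewrite mevalXU|by exists 1 => p'; rewrite meval1|].
    by move=> p' _ _; rewrite oner_neq0 divr1.
  move=> c; rewrite hF (dehomP hF1 (chart_point_in i _)) -/(chart_coord i _) chart_pointK //.
- by move=> P; apply: val_inj => /=; rewrite mxE chart_coordK //; exact: (valP P).
move=> [c []]; rewrite /phi /psi /=; set z := const_mx _.
by have -> : z = c by apply/rowP => j; rewrite mxE chart_pointK (ord1 j).
Qed.

Lemma chart_cover P : chart_set ord0 P \/ chart_set (rev_ord ord0) P.
Proof.
apply: NNPP => /not_or_and[/negP/negPn/eqP h0 /negP/negPn/eqP h1].
have : vpick (val P) != 0 by rewrite vpick0 -dimv_eq0 (eqP (valP P)).
case/eqP; apply/rowP => j; rewrite mxE -/(hcoord P j).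
by case: (ord2_case ord0 j) => ->.
Qed.

Lemma chart_coord_inv i P : chart_set i P -> chart_set (rev_ord i) P ->
  chart_coord i P * chart_coord (rev_ord i) P = 1.
Proof.
rewrite /chart_set /chart_coord rev_ordK => h h'; by field; rewrite h h'.
Qed.

Lemma chart_coord_neq0 i P : chart_set i P -> chart_coord i P != 0 -> chart_set (rev_ord i) P.
Proof. by rewrite /chart_set /chart_coord mulf_eq0 negb_or => _ /andP[]. Qed.

Lemma form_frac i (W : P1 -> Prop) g P : opn W -> W P -> chart_set i P -> reg W g ->
  exists u a b : {poly k}, u.[chart_coord i P] != 0 /\
    forall Q, chart_set i Q -> u.[chart_coord i Q] != 0 ->
     [/\ W Q, b.[chart_coord i Q] != 0 & g Q = a.[chart_coord i Q] / b.[chart_coord i Q]].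
Proof.
move=> oW WP Pi rg.
have [V [d [a [b [oV VP [A A1 hA] [B B1 hB] ab]]]]] := rg P WP.
have /quotient_opnP oI := opnI lP oV oW.
have [e [c [[C C1 hC] cP cW]]] := oI _ (conj VP WP).
have cE Q : chart_set i Q -> (c Q != 0) = ((dehom i C).[chart_coord i Q] != 0).
  by move=> Qi; rewrite hC (dehomP C1 Qi) mulf_eq0 expf_eq0 (negPf Qi) andbF.
exists (dehom i C), (dehom i A), (dehom i B); rewrite -cE //; split => // Q Qi.
rewrite -cE // => /cW[VQ WQ]; have [bQ ->] := ab Q WQ VQ.
move: bQ; rewrite hA hB (dehomP A1 Qi) (dehomP B1 Qi) mulf_eq0 negb_or => /andP[l0 bQ].
by split => //; field; rewrite bQ l0.
Qed.

(** In lowest terms the denominator of G is the same at all points, and has no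
    root. *)
Lemma locally_ratio_poly (G : k -> k) :
  (forall c, exists u a b : {poly k}, u.[c] != 0 /\ forall c', u.[c'] != 0 ->
     b.[c'] != 0 /\ G c' = a.[c'] / b.[c']) ->
  exists p : {poly k}, forall c, G c = p.[c].
Proof.
move=> h; have [u [a [b [u0 hab]]]] := h 0.
have un : u != 0 by apply: contra_neq u0 => ->; rewrite horner0.
have bn : b != 0 by apply: contra_neq (hab 0 u0).1 => ->; rewrite horner0.
set g := gcdp a b; pose a' := a %/ g; pose b' := b %/ g.
have aE : a = a' * g by rewrite divpK // dvdp_gcdl.
have bE : b = b' * g by rewrite divpK // dvdp_gcdr.
have cop : coprimep a' b' by apply: coprimep_div_gcd; rewrite bn orbT.
have g0 : g != 0 by rewrite gcdp_eq0 negb_and bn orbT.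
have cross u2 a2 b2 : u2 != 0 -> (forall c, u2.[c] != 0 -> b2.[c] != 0 /\ G c = a2.[c] / b2.[c]) ->
    a' * b2 = a2 * b'.
  move=> u2n h2; have e0 : (a' * b2 - a2 * b') * g * u * u2 = 0.
    apply: poly_eq_nonzero => c _; rewrite horner0 !hornerM.
    have [->|uc] := eqVneq u.[c] 0; first by rewrite mulr0 mul0r.
    have [->|u2c] := eqVneq u2.[c] 0; first by rewrite mulr0.
    have [bc Gc] := hab c uc; have [b2c] := h2 c u2c; rewrite Gc => E.
    have : (a' * b2 - a2 * b').[c] * g.[c] = a.[c] * b2.[c] - a2.[c] * b.[c].
      by rewrite aE bE !hornerE /=; ring.
    move=> ->; have -> : a.[c] * b2.[c] = a2.[c] * b.[c].
      by rewrite -[a.[c]](divfK bc) E mulrAC divfK.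
    by rewrite subrr !mul0r.
  move/eqP: e0; rewrite !mulf_eq0 (negPf g0) (negPf un) (negPf u2n) !orbF subr_eq0.
  by move/eqP.
have nroot c : ~~ root b' c.
  apply/negP => bc; have [u2 [a2 [b2 [u2c h2]]]] := h c.
  have u2n : u2 != 0 by apply: contra_neq u2c => ->; rewrite horner0.
  have := congr1 (horner^~ c) (cross _ _ _ u2n h2); rewrite !hornerM (eqP bc) mulr0 => /eqP.
  rewrite mulf_eq0 (negPf (h2 c u2c).1) orbF => ac.
  by have /(_ c ac)/negP := coprimep_root cop; apply.
have /size_poly1P[be be0 b'E] : size b' == 1%N.
  by apply: contraT => /closed_rootP[c bc]; have := nroot c; rewrite bc.
exists (be^-1 *: a') => c; have [u2 [a2 [b2 [u2c h2]]]] := h c.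
have u2n : u2 != 0 by apply: contra_neq u2c => ->; rewrite horner0.
have [b2c ->] := h2 c u2c.
have := congr1 (horner^~ c) (cross _ _ _ u2n h2); rewrite b'E !hornerE /= => E.
apply: (mulfI be0); apply: (mulIf b2c).
rewrite mulVKf // E; by field.
Qed.

Lemma reg_chart_poly i g : reg (chart_set i) g ->
  exists p : {poly k}, forall P, chart_set i P -> g P = p.[chart_coord i P].
Proof.
move=> rg; have [|p pE] := @locally_ratio_poly (fun c => g (chart_point i c)).
  move=> c; have Pi := chart_point_in i c.
  have [u [a [b [u0 h]]]] := form_frac (opn_chart_set i) Pi Pi rg.
  exists u, a, b; split; first by move: u0; rewrite chart_pointK.
  by move=> c' uc'; have := h _ (chart_point_in i c'); rewrite chart_pointK => /(_ uc')[].
by exists p => P Pi; rewrite -pE chart_coordK.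
Qed.
End ProjectiveLine.

Arguments chart_set {k} i P.
Arguments chart_coord {k} i P.

(** * From the function field to the charts *)

Section FunctionField.
Variables (k : closedFieldType) (X : fun_space k).
Hypothesis lX : lawful X.
Hypothesis iX : irreducible X.
Variable K : function_field X.
Implicit Types (U V W : X -> Prop) (f g h : X -> k).

(** Pairs of a nonempty open set and a regular function on it, representing
    elements of the function field. *)
Definition sect U f := [/\ opn U, nonempty U & reg U f].

Lemma ev_generic U V f g : sect U f -> sect V g ->
  (ev K U f = ev K V g <-> generic (fun P => f P = g P)).
Proof.
move=> [oU nU rf] [oV nV rg]; split.
  move/(ev_eq K oU nU rf oV nV rg) => [W [oW nW h]]; exists W; split => // P WP.
  by have [] := h P WP.
move=> e; apply/(ev_eq K oU nU rf oV nV rg).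
have [W [oW nW h]] := generic3 lX iX (fun P a b c => And3 a b c) (generic_opn oU nU) (generic_opn oV nV) e.
by exists W; split => // P /h[].
Qed.

Lemma evM_generic U V W f g h : sect U f -> sect V g -> sect W h ->
  generic (fun P => f P * g P = h P) -> ev K U f * ev K V g = ev K W h.
Proof.
move=> sf sg sh e; have [oU nU rf] := sf; have [oV nV rg] := sg.
have oI := opnI lX oU oV; have nI := opn_meet iX oU nU oV nV.
have rf' : reg (fun P => U P /\ V P) f by apply: (reg_sub lX oU oI rf) => P [].
have rg' : reg (fun P => U P /\ V P) g by apply: (reg_sub lX oV oI rg) => P [].
have -> : ev K U f = ev K (fun P => U P /\ V P) f.
  by apply/ev_generic => //; apply: genericT.
have -> : ev K V g = ev K (fun P => U P /\ V P) g.
  by apply/ev_generic => //; apply: genericT.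
rewrite -evM //; apply/ev_generic => //; split => //; exact: regM.
Qed.

Lemma ev_zero U : opn U -> nonempty U -> ev K U (fun _ => 0) = 0.
Proof.
move=> oU nU; have r0 := reg_cst lX 0 oU.
apply: (addrI (ev K U (fun _ => 0))); rewrite addr0 -evD //.
by apply/ev_generic => //; [split => //; exact: regD|apply: genericT => // P; rewrite addr0].
Qed.

Lemma ev_eq0 U f : sect U f -> (ev K U f = 0 <-> generic (fun P => f P = 0)).
Proof.
move=> sf; have [oU nU _] := sf; rewrite -(ev_zero oU nU); apply: ev_generic => //.
by split => //; exact: reg_cst.
Qed.
End FunctionField.

Section DoubleCover.
Variables (k : closedFieldType) (X : fun_space k).
Hypothesis lX : lawful X.
Hypothesis iX : irreducible X.
Hypothesis smX : smooth_of_dim X 1.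
Variable phi : X -> proj_space k 1.
Hypothesis fphi : finite_morphism phi.
Hypothesis sphi : separable_of_degree phi 2.
Variable i : 'I_2.

Let mphi : morphism phi := fphi.1.
Let Vi : proj_space k 1 -> Prop := chart_set i.
Let oVi : opn Vi := opn_chart_set k i.
Let U (P : X) := Vi (phi P).
Let x (P : X) := chart_coord i (phi P).
Let oU : opn U := (mphi oVi).1.
Let rx : reg U x := (mphi oVi).2 _ (@reg_chart_coord k i).
Let lP := lawful_proj k 1.
Let nVi : nonempty Vi.
Proof. by exists (chart_point i 0); exact: chart_point_in. Qed.
Let nU : nonempty U := sphi.1 _ oVi nVi.
Let rp (p : {poly k}) : reg U (fun P => p.[x P]).
Proof. exact: reg_poly. Qed.

Lemma dominant_coord (p : {poly k}) : p != 0 -> exists P, U P /\ p.[x P] != 0.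
Proof.
move=> /closed_nonrootP[c pc].
have rV := reg_poly lP p oVi (@reg_chart_coord k i).
have oN := opn_neq0 lP oVi rV.
have [|P [UP pP]] := sphi.1 _ oN; last by exists P.
by exists (chart_point i c); split; [exact: chart_point_in|rewrite chart_pointK].
Qed.

Lemma coord_generic0 (p : {poly k}) : generic (fun P => p.[x P] = 0) -> p = 0.
Proof.
move=> e; apply/eqP; apply: contraT => /dominant_coord[P [UP pP]].
by move: pP; rewrite (reg_generic lX iX oU (rp p) (reg_cst lX 0 oU) e UP) eqxx.
Qed.

(** Every element of the function field of the line is a quotient p(x)/q(x).  Three
    elements of a space of dimension 2 are dependent, which gives the first part.
    If all regular functions were in k(x), then so would be all their
    quotients, that is the whole function field, which has dimension 2 over k(x). *)
Lemma degree2_charts :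
  (forall w0 w1 w2, reg U w0 -> reg U w1 -> reg U w2 ->
    exists p0 p1 p2 : {poly k}, ~ [/\ p0 = 0, p1 = 0 & p2 = 0] /\
      forall P, U P -> p0.[x P] * w0 P + p1.[x P] * w1 P + p2.[x P] * w2 P = 0) /\
  (localizes U -> exists w, reg U w /\
    forall n p : {poly k}, (forall P, U P -> n.[x P] * w P = p.[x P]) -> n = 0).
Proof.
have [dom [KX [KY [iota [iotaE [b hb] _]]]]] := sphi.
pose evx (p : {poly k}) : KX := ev KX U (fun P => p.[x P]).
have sx (p : {poly k}) : sect U (fun P => p.[x P]) by split.
have evx0 p : p != 0 -> evx p != 0.
  apply: contra_neq => /(ev_eq0 lX iX KX (sx p)); exact: coord_generic0.
have evxM p q : evx (p * q) = evx p * evx q.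
  by symmetry; apply: evM_generic => //; apply: genericT => // P; rewrite hornerM.
have evx_iota p : evx p = iota (ev KY Vi (fun Q => p.[chart_coord i Q])).
  have rV : reg Vi (fun Q => p.[chart_coord i Q]) := reg_poly lP p oVi (@reg_chart_coord k i).
  by rewrite (iotaE _ _ oVi nVi rV).
have frac (c : KY) : exists pq : {poly k} * {poly k}, pq.2 != 0 /\ evx pq.2 * iota c = evx pq.1.
  have [W [g [oW nW rg ->]]] := ev_surj c.
  rewrite iotaE //; have [oWX rgX] := mphi oW; have nWX := dom _ oW nW.
  have [P [WP UP]] := opn_meet iX oWX nWX oU nU.
  have [u [p [q [u0 h]]]] := form_frac oW WP UP rg.
  have q0 : q != 0.
    by have [_ qP _] := h _ UP u0; apply: contra_neq qP => ->; rewrite horner0.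
  exists (p, q); split => //=.
  apply: evM_generic => //; first by split => //; exact: rgX.
  exists (fun Q => U Q /\ u.[x Q] != 0); split; first exact: opn_neq0.
    by exists P.
  by move=> Q [UQ uQ]; have [_ qQ ->] := h (phi Q) UQ uQ; rewrite mulrC divfK.
split=> [w0 w1 w2 r0 r1 r2|loc].
  pose z (j : 'I_3) : KX := [eta (fun _ => 0) with 0%N |-> ev KX U w0, 1%N |-> ev KX U w1, 2%N |-> ev KX U w2] (j : nat).
  have/fin_all_exists[a ha] (j : 'I_3) : exists a : {ffun 'I_2 -> KY}, z j = \sum_n iota (a n) * b n.
    by have [a [e _]] := hb (z j); exists a.
  have [c [j cj] hc] := left_kernel (\matrix_(j < 3, n < 2) a j n) isT.
  have/fin_all_exists[pq hpq] (j' : 'I_3) := frac (c j').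
  have sum0 : \sum_j iota (c j) * z j = 0.
    under eq_bigr do rewrite ha mulr_sumr.
    rewrite exchange_big big1 // => n _; under eq_bigr do rewrite mulrA -rmorphM.
    rewrite -mulr_suml -rmorph_sum; have := hc n; under eq_bigr do rewrite mxE.
    by move=> ->; rewrite rmorph0 mul0r.
  pose j0 : 'I_3 := inord 0; pose j1 : 'I_3 := inord 1; pose j2 : 'I_3 := inord 2.
  have sum3 (R : nmodType) (h : 'I_3 -> R) : \sum_j h j = h j0 + h j1 + h j2.
    rewrite !big_ord_recl big_ord0 addr0 addrA; congr (h _ + h _ + h _); apply: val_inj => /=;
    by rewrite inordK.
  exists ((pq j0).1 * ((pq j1).2 * (pq j2).2)), ((pq j1).1 * ((pq j0).2 * (pq j2).2)),
    ((pq j2).1 * ((pq j0).2 * (pq j1).2)).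
  set p0 := (pq j0).1 * _; set p1 := (pq j1).1 * _; set p2 := (pq j2).1 * _.
  pose Q := evx (pq j0).2 * evx (pq j1).2 * evx (pq j2).2.
  have E0 : evx p0 = Q * iota (c j0) by rewrite !evxM -(hpq j0).2 /Q; ring.
  have E1 : evx p1 = Q * iota (c j1) by rewrite !evxM -(hpq j1).2 /Q; ring.
  have E2 : evx p2 = Q * iota (c j2) by rewrite !evxM -(hpq j2).2 /Q; ring.
  have Q0 : Q != 0 by rewrite !mulf_neq0 // evx0 // (hpq _).1.
  have evx_0 : evx 0 = 0.
    by apply/(ev_eq0 lX iX KX (sx 0)); apply: genericT => // P; rewrite horner0.
  split.
    case=> p00 p10 p20; move: cj; rewrite p00 p10 p20 evx_0 in E0 E1 E2.
    have cz m : 0 = Q * iota (c m) -> c m = 0.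
      by move/esym/eqP; rewrite mulf_eq0 (negPf Q0) fmorph_eq0 => /eqP.
    (* the sum of the indicators of c m != 0 is 0, but c j != 0 *)
    have := sum3 _ (fun m => (c m != 0)%:R : nat); rewrite (cz _ E0) (cz _ E1) (cz _ E2) eqxx /=.
    by rewrite (bigD1 j) //= => h; case: (c j != 0) h.
  have rt p w : reg U w -> reg U (fun P => p.[x P] * w P) by move=> rw; exact: regM.
  have ez0 : z j0 = ev KX U w0 by rewrite /z /= inordK.
  have ez1 : z j1 = ev KX U w1 by rewrite /z /= inordK.
  have ez2 : z j2 = ev KX U w2 by rewrite /z /= inordK.
  have rS : reg U (fun P => p0.[x P] * w0 P + p1.[x P] * w1 P + p2.[x P] * w2 P).
    by apply: (regD lX oU); [apply: (regD lX oU)|]; exact: rt.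
  apply: (reg_generic lX iX oU rS (reg_cst lX 0 oU)).
  apply/(ev_eq0 lX iX KX (And3 oU nU rS)).
  rewrite evD //; [|by apply: (regD lX oU); exact: rt|exact: rt].
  rewrite evD //; [|exact: rt|exact: rt].
  rewrite !evM // -/(evx p0) -/(evx p1) -/(evx p2) E0 E1 E2 -ez0 -ez1 -ez2.
  have := sum0; rewrite sum3 => e; transitivity (Q * (iota (c j0) * z j0 + iota (c j1) * z j1 + iota (c j2) * z j2)); first by ring.
  by rewrite e mulr0.
apply: NNPP => nex.
have rat w : reg U w -> exists n p : {poly k}, n != 0 /\ forall P, U P -> n.[x P] * w P = p.[x P].
  move=> rw; apply: NNPP => h; apply: nex; exists w; split => // n p e.
  by apply/eqP; apply: contraT => n0; case: h; exists n, p.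
have all_iota (z : KX) : exists c, z = iota c.
  have [W [f [oW nW rf ->]]] := ev_surj z.
  have [P [WP UP]] := opn_meet iX oW nW oU nU.
  have [A [B [rA rB BP AB]]] := loc W f P oW WP UP rf.
  have [n1 [p1 [n10 h1]]] := rat A rA; have [n2 [p2 [n20 h2]]] := rat B rB.
  have gB : generic (fun Q => U Q /\ B Q != 0).
    by apply: generic_opn; [exact: opn_neq0|exists P].
  have e : evx (n1 * p2) * ev KX W f = evx (p1 * n2).
    apply: evM_generic => //; apply: generic1 gB => Q [UQ BQ].
    have [_ ->] := AB Q UQ BQ; rewrite !hornerM -h1 // -h2 //; by field.
  have p20 : p2 != 0.
    apply/eqP => p20; have [Q [UQ nQ]] := dominant_coord n20.
    have gn : generic (fun Q => U Q /\ n2.[x Q] != 0).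
      by apply: generic_opn; [exact: opn_neq0|exists Q].
    have [R [[UR BR] [_ nR]]] := generic_ex (generic2 lX iX (fun P a b => conj a b) gB gn).
    by have /eqP := h2 R UR; rewrite p20 horner0 mulf_eq0 (negPf BR) (negPf nR).
  exists (ev KY Vi (fun Q => (p1 * n2).[chart_coord i Q]) / ev KY Vi (fun Q => (n1 * p2).[chart_coord i Q])).
  rewrite fmorph_div -!evx_iota -e mulrAC divff ?mul1r // evx0 // mulf_neq0 //.
have [c0 e0] := all_iota (b ord0); have [c1 e1] := all_iota (b (lift ord0 ord0)).
have [a [_ uniq]] := hb 0.
pose a1 : {ffun 'I_2 -> KY} := [ffun n => if n == ord0 then c1 else - c0].
pose a2 : {ffun 'I_2 -> KY} := [ffun n => 0].
(* c1 b0 - c0 b1 = 0 is a second expression of 0 in the basis unless c0 = c1 = 0 *)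
have u1 : a = a1.
  apply: uniq; rewrite big_ord_recl big_ord1 !ffunE /= e0 e1 rmorphN; ring.
have u2 : a = a2.
  by apply: uniq; rewrite big_ord_recl big_ord1 !ffunE rmorph0 !mul0r addr0.
have c10 : c1 = 0 by have := congr1 (fun a : {ffun _ -> _} => a ord0) (etrans (esym u1) u2); rewrite !ffunE.
have c00 : c0 = 0.
  have := congr1 (fun a : {ffun _ -> _} => a (lift ord0 ord0)) (etrans (esym u1) u2).
  by rewrite !ffunE /= => /eqP; rewrite oppr_eq0 => /eqP.
have u3 : a = [ffun n => 1].
  by apply: uniq; rewrite big_ord_recl big_ord1 !ffunE e0 e1 c00 c10 rmorph0 !mulr0 addr0.
have := congr1 (fun a : {ffun _ -> _} => a ord0) (etrans (esym u3) u2).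
by rewrite !ffunE => /eqP; rewrite oner_eq0.
Qed.

Theorem chart_of_double_cover : chart U x.
Proof.
have aff := fphi.2 _ oVi (affine_chart_set k i).
have loc : localizes U by apply: affine_localizes => //; exact: aff.1.
have [dep indep] := degree2_charts.
split => //.
- exact: dominant_coord.
- have [r [a [ra span]]] := aff.2; exists r, a; split => // w /span[b rb wE].
  have/fin_all_exists[p hp] j := reg_chart_poly (rb j).
  by exists p => P UP; rewrite wE //; apply: eq_bigr => j _; rewrite hp.
- exact: indep.
by move=> P _; exact: smX.2.
Qed.
End DoubleCover.

Theorem mainTheorem5 (k : closedFieldType) (hk : 11%N \in [pchar k]) :
  ~ exists X : fun_space k, [/\ hyperelliptic X, superspecial 11 X & genus X 4].
Proof.
case=> X [[[prX iX smX] [phi [fphi sphi]]] ss g4].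
have lX := lawful_projective prX.
have e11 : 11%:R = 0 :> k by apply/eqP; case/andP: hk.
have two_neq0 : 2%:R != 0 :> k by rewrite natr_eq0_11.
pose U i (P : X) := chart_set i (phi P); pose x i (P : X) := chart_coord i (phi P).
have ch i : chart (U i) (x i) by exact: chart_of_double_cover.
have [y [f dc]] := chart_dcover lX iX two_neq0 (ch ord0).
have [y' [f' dc']] := chart_dcover lX iX two_neq0 (ch (rev_ord ord0)).
have gl i : inverse_charts (U i) (U (rev_ord i)) (x i) (x (rev_ord i)).
  split; [move=> P; exact: chart_coord_neq0|move=> P; exact: chart_coord_inv|
    exact: ch_opn|exact: ch_opn|].
  by split; [have [P [? _]] := ch_dom (ch i) (oner_neq0 _)|have [P [? _]] := ch_dom (ch (rev_ord i)) (oner_neq0 _)]; exists P.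
have gl' := gl (rev_ord ord0); rewrite rev_ordK in gl'.
have [e [l [c [c0 hy]]]] := odd_coordinates_proportional lX iX two_neq0 dc dc' (gl ord0) gl'.
exact: (genus4_charts_absurd lX iX e11 dc dc' (gl ord0) (fun P => chart_cover (phi P)) c0 hy ss g4).
Qed.
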